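(* Let $C, D \in \mathbb{Q}$ be nonzero and let $f(x,y) = Cx^2 + Dy^2$. Let $R_{C,D}(y), S_{C,D}(y) \in \mathbb{Q}[y]$ be the polynomials defined in the context. (1) The form $f$ has a periodic vector of type $(L,R,L,R)$ over $\overline{\mathbb{Q}}$ if and only if $C \neq D$. Moreover, there is a polynomial $G_{C,D}(y) \in \mathbb{Q}[y]$ such that $$y \longmapsto (G_{C,D}(y), y)$$ is a bijection from the set of roots of $R_{C,D}(y)$ in $\overline{\mathbb{Q}}$ to the set of periodic vectors of type $(L,R,L,R)$ for $f$ over $\overline{\mathbb{Q}}$. In particular: there are at most $4$ periodic vectors of type $(L,R,L,R)$ for $f$ over $\mathbb{C}$; the coordinates of any periodic vector of this type for $f$ generate a number field of degree at most $4$ over $\mathbb{Q}$, with degree exactly $4$ being the generic behavior (that is, there is a thin subset of $\mathbb{Q}^2$ such that whenever $(C,D)$ lies outside it the degree is exactly $4$); and for every number field $K$, the form $f$ has a periodic vector of type $(L,R,L,R)$ with both coordinates in $K$ if and only if $R_{C,D}(y)$ has a root in $K$. (2) The $y$-coordinate of each periodic vector $(x,y)$ of type $(L,L,R,L,R)$ for $f$ over $\overline{\mathbb{Q}}$ is a root of $S_{C,D}(y)$, and $S_{C,D}(y)$ has degree $10$ unless $C = -D$ or $C^2 - 3CD + 4D^2 = 0$. If $C \neq D$, then there is a polynomial $H_{C,D}(y) \in \mathbb{Q}[y]$ such that $$y \longmapsto (H_{C,D}(y), y)$$ is a bijection from the set of roots of $S_{C,D}(y)$ in $\overline{\mathbb{Q}}$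 to the set of periodic vectors of type $(L,L,R,L,R)$ for $f$ over $\overline{\mathbb{Q}}$. In particular: there are at most $10$ periodic vectors of type $(L,L,R,L,R)$ for $f$ over $\mathbb{C}$; the coordinates of any periodic vector of this type for $f$ generate a number field of degree at most $10$ over $\mathbb{Q}$, with degree exactly $10$ being the generic behavior (that is, there is a thin subset of $\mathbb{Q}^2$ such that whenever $(C,D)$ lies outside it the degree is exactly $10$); and for every number field $K$, if $f$ has a periodic vector of type $(L,L,R,L,R)$ with both coordinates in $K$, then $S_{C,D}(y)$ has a root in $K$.
   Context: Replacement dynamics. Let $F$ be a field containing $\mathbb{Q}$ and regard $f$ as a function $F^2 \to F$. Define $f_L, f_R : F^2 \to F^2$ by $f_L(x,y) = (f(x,y), y)$ and $f_R(x,y) = (x, f(x,y))$. For a type $\mathbf{t} = (t_1,\ldots,t_N) \in \{L,R\}^N$ put $f_{\mathbf{t}} = f_{t_N} \circ \cdots \circ f_{t_1}$. A vector $\overline{v} \in F^2$ is a periodic vector of type $\mathbf{t}$ for $f$ (over $F$) if $f_{\mathbf{t}}(\overline{v}) = \overline{v}$ and $f_{(t_1,\ldots,t_{N'})}(\overline{v}) \neq \overline{v}$ for all $1 \leq N' < N$. The polynomial $R_{C,D}(y)$ is obtained by substituting $(c,d) = (C,D)$ in $$R(y) = 16c^2d^3(d-c)^2 y^4 + 8cd^2(d+c)(d-c)^2y^3 + (d^4+6cd^3+12c^2d^2-2c^3d-c^4)(d-c)y^2 + (d^3+7cd^2-3c^2d-c^3)(d-c)y + (d^3-2cd^2+5c^2d+c^3).$$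 The polynomial $S_{C,D}(y)$ is obtained by substituting $(c,d) = (C,D)$ in $$S(y) = 256c^7d^6(c+d)^2(c^2 - 3cd + 4d^2)y^{10} + 256c^7d^6(c+d)a_9y^9 + 32c^5d^3(c+d)a_8 y^8 + 16c^5d^3a_7y^7 + \sum_{i=0}^{6} a_i y^i,$$ where $a_0 = c^7 + 7c^6d + 21c^5d^2 + 37c^4d^3 - 7c^3d^4 + 91c^2d^5 - 6cd^6 + d^7$, $a_1 = c^8 - 25c^6d^2 - 59c^5d^3 - 76c^4d^4 + 190c^3d^5 + 56c^2d^6 + 10cd^7 + d^8$, $a_2 = c^9 + c^8d + 7c^7d^2 + 104c^6d^3 + 55c^5d^4 + 12c^4d^5 + 38c^3d^6 + 96c^2d^7 + 9cd^8 + d^9$, $a_3 = c(c^9 + 2c^8d + 8c^7d^2 + 30c^6d^3 - 192c^5d^4 + 210c^4d^5 - 112c^3d^6 + 40c^2d^7 - 16cd^8 + 16d^9)$, $a_4 = c^2(c^9 + c^8d - 14c^7d^2 - 30c^6d^3 - 146c^5d^4 + 208c^4d^5 + 234c^3d^6 - 128c^2d^7 - 136cd^8 + 32d^9)$, $a_5 = c^3(c^9 + 2c^8d + 9c^7d^2 + 112c^6d^3 + 56c^5d^4 + 160c^4d^5 - 32c^3d^6 - 496c^2d^7 + 48cd^8 - 96d^9)$, $a_6 = c^3(c^{10} + 3c^9d + 11c^8d^2 + 41c^7d^3 - 152c^6d^4 + 264c^5d^5 + 144c^4d^6 + 240c^3d^7 - 64c^2d^8 - 288cd^9 + 64d^{10})$,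 $a_7 = c^6 - 7c^4d^2 + 54c^3d^3 + 36c^2d^4 + 8cd^5 - 32d^6$, $a_8 = c^6 + 5c^4d^2 - 14c^3d^3 + 28c^2d^4 + 40cd^5 - 16d^6$, $a_9 = -2cd+6d^2$. ''Thin subset of $\mathbb{Q}^2$'' is meant in the usual sense of Serre (as in Hilbert's irreducibility theorem). *)

(* Defs.v *)
From HB Require Import structures.
From mathcomp Require Import all_boot all_order all_algebra all_field.
From mathcomp Require Import classical_sets functions cardinality reals complex.
From mathcomp Require Import mpoly.

Set Implicit Arguments.
Unset Strict Implicit.
Unset Printing Implicit Defensive.

Import Order.TTheory GRing.Theory Num.Theory.
Local Open Scope ring_scope.

Inductive letter := L | R.

Definition replace (T : Type) (f : T -> T -> T) (l : letter) (v : T * T) : T * T :=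
  match l with
  | L => (f v.1 v.2, v.2)
  | R => (v.1, f v.1 v.2)
  end.

(* The letters act in the order in which they are listed:
   f_(t_1, ..., t_N) = f_(t_N) \o ... \o f_(t_1). *)
Definition replace_seq (T : Type) (f : T -> T -> T) (t : seq letter) (v : T * T)
    : T * T :=
  foldl (fun w l => replace f l w) v t.

Definition periodic (T : Type) (f : T -> T -> T) (t : seq letter) (v : T * T)
    : Prop :=
  replace_seq f t v = v /\
  forall N, (1 <= N < size t)%N -> replace_seq f (take N t) v <> v.

(* [ratr] is the embedding of the rationals when F has characteristic 0. *)
Definition diag_form (F : fieldType) (C D : rat) (x y : F) : F :=
  ratr C * x ^+ 2 + ratr D * y ^+ 2.
Arguments diag_form F C D x y : clear implicits.

Definition roots_in (F : fieldType) (p : {poly rat}) : set F :=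
  [set y : F | root (map_poly ratr p) y]%classic.
Arguments roots_in F p : clear implicits.

Definition periodic_vectors (F : fieldType) (C D : rat) (t : seq letter)
    : set (F * F) :=
  [set v : F * F | periodic (diag_form F C D) t v]%classic.
Arguments periodic_vectors F C D t : clear implicits.

(* The subfield Q(s) of F is a number field of degree n: it is the image of an
   abstract number field K that is generated by preimages of the elements
   of s. *)
Definition generates_number_field (F : fieldType) (s : seq F) (n : nat) : Prop :=
  exists (K : fieldExtType rat) (phi : {rmorphism K -> F}) (s' : seq K),
    [/\ map phi s' = s, <<1 & s'>>%VS = fullv & \dim {: K} = n].

Definition R_poly (c d : rat) : {poly rat} :=
  (16 * c ^+ 2 * d ^+ 3 * (d - c) ^+ 2) *: 'X^4
  + (8 * c * d ^+ 2 * (d + c) * (d - c) ^+ 2) *: 'X^3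
  + ((d ^+ 4 + 6 * c * d ^+ 3 + 12 * c ^+ 2 * d ^+ 2 - 2 * c ^+ 3 * d - c ^+ 4)
       * (d - c)) *: 'X^2
  + ((d ^+ 3 + 7 * c * d ^+ 2 - 3 * c ^+ 2 * d - c ^+ 3) * (d - c)) *: 'X
  + (d ^+ 3 - 2 * c * d ^+ 2 + 5 * c ^+ 2 * d + c ^+ 3)%:P.

Definition S_poly (c d : rat) : {poly rat} :=
  let a0 := c ^+ 7 + 7 * c ^+ 6 * d + 21 * c ^+ 5 * d ^+ 2
            + 37 * c ^+ 4 * d ^+ 3 - 7 * c ^+ 3 * d ^+ 4
            + 91 * c ^+ 2 * d ^+ 5 - 6 * c * d ^+ 6 + d ^+ 7 in
  let a1 := c ^+ 8 - 25 * c ^+ 6 * d ^+ 2 - 59 * c ^+ 5 * d ^+ 3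
            - 76 * c ^+ 4 * d ^+ 4 + 190 * c ^+ 3 * d ^+ 5
            + 56 * c ^+ 2 * d ^+ 6 + 10 * c * d ^+ 7 + d ^+ 8 in
  let a2 := c ^+ 9 + c ^+ 8 * d + 7 * c ^+ 7 * d ^+ 2
            + 104 * c ^+ 6 * d ^+ 3 + 55 * c ^+ 5 * d ^+ 4
            + 12 * c ^+ 4 * d ^+ 5 + 38 * c ^+ 3 * d ^+ 6
            + 96 * c ^+ 2 * d ^+ 7 + 9 * c * d ^+ 8 + d ^+ 9 in
  let a3 := c * (c ^+ 9 + 2 * c ^+ 8 * d + 8 * c ^+ 7 * d ^+ 2
            + 30 * c ^+ 6 * d ^+ 3 - 192 * c ^+ 5 * d ^+ 4
            + 210 * c ^+ 4 * d ^+ 5 - 112 * c ^+ 3 * d ^+ 6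
            + 40 * c ^+ 2 * d ^+ 7 - 16 * c * d ^+ 8 + 16 * d ^+ 9) in
  let a4 := c ^+ 2 * (c ^+ 9 + c ^+ 8 * d - 14 * c ^+ 7 * d ^+ 2
            - 30 * c ^+ 6 * d ^+ 3 - 146 * c ^+ 5 * d ^+ 4
            + 208 * c ^+ 4 * d ^+ 5 + 234 * c ^+ 3 * d ^+ 6
            - 128 * c ^+ 2 * d ^+ 7 - 136 * c * d ^+ 8 + 32 * d ^+ 9) in
  let a5 := c ^+ 3 * (c ^+ 9 + 2 * c ^+ 8 * d + 9 * c ^+ 7 * d ^+ 2
            + 112 * c ^+ 6 * d ^+ 3 + 56 * c ^+ 5 * d ^+ 4
            + 160 * c ^+ 4 * d ^+ 5 - 32 * c ^+ 3 * d ^+ 6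
            - 496 * c ^+ 2 * d ^+ 7 + 48 * c * d ^+ 8 - 96 * d ^+ 9) in
  let a6 := c ^+ 3 * (c ^+ 10 + 3 * c ^+ 9 * d + 11 * c ^+ 8 * d ^+ 2
            + 41 * c ^+ 7 * d ^+ 3 - 152 * c ^+ 6 * d ^+ 4
            + 264 * c ^+ 5 * d ^+ 5 + 144 * c ^+ 4 * d ^+ 6
            + 240 * c ^+ 3 * d ^+ 7 - 64 * c ^+ 2 * d ^+ 8
            - 288 * c * d ^+ 9 + 64 * d ^+ 10) in
  let a7 := c ^+ 6 - 7 * c ^+ 4 * d ^+ 2 + 54 * c ^+ 3 * d ^+ 3
            + 36 * c ^+ 2 * d ^+ 4 + 8 * c * d ^+ 5 - 32 * d ^+ 6 in
  let a8 := c ^+ 6 + 5 * c ^+ 4 * d ^+ 2 - 14 * c ^+ 3 * d ^+ 3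
            + 28 * c ^+ 2 * d ^+ 4 + 40 * c * d ^+ 5 - 16 * d ^+ 6 in
  let a9 := - 2 * c * d + 6 * d ^+ 2 in
  (256 * c ^+ 7 * d ^+ 6 * (c + d) ^+ 2
     * (c ^+ 2 - 3 * c * d + 4 * d ^+ 2)) *: 'X^10
  + (256 * c ^+ 7 * d ^+ 6 * (c + d) * a9) *: 'X^9
  + (32 * c ^+ 5 * d ^+ 3 * (c + d) * a8) *: 'X^8
  + (16 * c ^+ 5 * d ^+ 3 * a7) *: 'X^7
  + \sum_(i < 7) [:: a0; a1; a2; a3; a4; a5; a6]`_i *: 'X^i.

(* Thin sets are meant in the sense of Serre.  An irreducible affine variety V
   over Q is given by a prime ideal P of
   Q[x_1, ..., x_m], and a morphism pi from V to the affine n-space by n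
   polynomials, taken modulo P.  Affine varieties suffice for Serre's type
   (C2): replacing a variety by a nonempty affine open subset removes from the
   image of its rational points a set of type (C1). *)

Definition dominant (m n : nat) (P : {pred {mpoly rat[m]}})
    (pi : n.-tuple {mpoly rat[m]}) : Prop :=
  forall q : {mpoly rat[n]}, q \mPo pi \in P -> q = 0.

(* The classes of u_1, ..., u_k in the function field of V are linearly
   independent over the function field Q(T_1, ..., T_n) of the affine space,
   which acts through pi; denominators have been cleared. *)
Definition function_field_free (m n k : nat) (P : {pred {mpoly rat[m]}})
    (pi : n.-tuple {mpoly rat[m]}) (u : k.-tuple {mpoly rat[m]}) : Prop :=
  forall a : 'I_k -> {mpoly rat[n]},
    \sum_(i < k) (a i \mPo pi) * tnth u i \in P -> forall i, a i = 0.

(* [Q(V) : Q(T_1, ..., T_n)] = k.  For dominant pi, finiteness of this degree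
   is the condition dim V = n. *)
Definition morphism_degree (m n : nat) (P : {pred {mpoly rat[m]}})
    (pi : n.-tuple {mpoly rat[m]}) (k : nat) : Prop :=
  (exists u : k.-tuple {mpoly rat[m]}, function_field_free P pi u) /\
  (forall u : k.+1.-tuple {mpoly rat[m]}, ~ function_field_free P pi u).

Definition thin_C1 (n : nat) (A : set (n.-tuple rat)) : Prop :=
  exists2 q : {mpoly rat[n]}, q != 0 & forall a, A a -> q.@[tnth a] = 0.

Definition thin_C2 (n : nat) (A : set (n.-tuple rat)) : Prop :=
  exists (m : nat) (P : {pred {mpoly rat[m]}}) (pi : n.-tuple {mpoly rat[m]})
         (k : nat),
    [/\ idealr_closed P /\ prime_idealr_closed P,
        dominant P pi,
        (2 <= k)%N /\ morphism_degree P pi k &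
        forall a, A a -> exists b : m.-tuple rat,
          (forall p, p \in P -> p.@[tnth b] = 0) /\
          forall i, tnth a i = (tnth pi i).@[tnth b]].

Definition thin (n : nat) (A : set (n.-tuple rat)) : Prop :=
  exists (r : nat) (B : 'I_r -> set (n.-tuple rat)),
    (forall j, thin_C1 (B j) \/ thin_C2 (B j)) /\
    (forall a, A a -> exists j, B j a).

(* Main.v *)
From Stdlib Require Import ZArith.
Require Import Defs.
From HB Require Import structures.
From mathcomp Require Import all_boot all_order all_algebra all_field.
From mathcomp Require Import classical_sets functions cardinality reals complex.
From mathcomp Require Import mpoly fingroup perm ring ssrZ.
Import Order.TTheory GRing.Theory Num.Theory.
Set Implicit Arguments.
Unset Strict Implicit.
Unset Printing Implicit Defensive.
Local Open Scope ring_scope.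
Delimit Scope Z_scope with BinZ.

(** The scaling (x, y) |-> (D x, D y) turns f into the normal form
    t x^2 + y^2 with t = C / D, so only one parameter matters.  Along a cycle
    x -> x1 -> ... -> x and y -> y1 -> y, a combination of the defining
    equations gives x + x1 = y + y1.  Let s be this common value and
    q = y1 - y = s - 2 y.  Then x = s - y + q s, so the vector is determined by
    (s, y), and the remaining conditions are two polynomial equations in t, s
    and y: E1 and E3 for the type LRLR, F1 and F2 for the type LLRLR.

    Eliminating s from the two equations gives R, respectively S, and shows
    that s is a polynomial in y with coefficients in Q(t); this is where the
    polynomials G and H come from.  The eliminations are checked by computing
    with lists of integer coefficients.  The denominators that occur are
    integer polynomials in t without rational roots, because they have none
    modulo a small prime, so they never vanish at t = C / D.  Conversely, for a
    root y of R the value of s given by the fraction satisfies E1 and E3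
    identically modulo R.  For S, where such an identity would be too large, a
    resultant computation shows instead that F1 and F2 have a common root s
    over an algebraically closed field, and the forward direction identifies
    that s.  The minimality of the period can fail only if y1 = y or, for
    LLRLR, x2 = x; the first forces t to be a root of a polynomial without
    rational roots, the second forces t = 1.

    A periodic vector lies in Q(y), which gives the bounds on the degrees, with
    equality as soon as R or S is irreducible.  Generic irreducibility is an
    instance of Hilbert's theorem, in the form [thin_reducible]: if a
    polynomial over Q[T_1, ..., T_m] is irreducible at a Zariski dense set of
    rational points, then the rational points where it is reducible or drops in
    degree form a thin set.  For R and S the dense set consists of the integer
    points congruent to (2, 1) modulo 13, at which the reduction modulo 13 is
    irreducible.  For a monic polynomial P over Q[T] with roots r_i in a
    splitting field over Q(T), consider the products of k of the factors
    X - r_i.  Each of them has a coefficient beta outside Q(T), and the points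
    where beta specialises to a rational number form a set of type (C2),
    attached to the variety with function field Q(T)(beta).  Outside these
    finitely many sets no specialisation of P has a rational factor of degree
    k, because an identity between the roots that holds for every ordering
    survives specialisation ([root_relation_specializes]). *)

(** * Number fields generated by a root *)

(** In characteristic 0 the images of denominators are invertible, which is
    what makes the total function [ratr] a ring morphism. *)
Lemma rat_morphism_pchar0 (F : fieldType) : [pchar F] =i pred0 ->
  {iota : {rmorphism rat -> F} | iota =1 @ratr F}.
Proof.
move/pcharf0P=> charF.
have injz (z : int) : (z%:~R == 0 :> F) = (z == 0).
  by case: z => n; rewrite ?NegzE ?mulrNz ?oppr_eq0 charF.
have nz_den x : (denq x)%:~R != 0 :> F by rewrite injz denq_eq0.
have fracE (x : rat) (n d : int) : d != 0 -> x * d%:~R = n%:~R ->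
    @ratr F x = n%:~R / d%:~R.
  move=> nzd xd; apply/eqP; rewrite eqr_div ?injz // -!intrM; apply/eqP.
  congr _%:~R; apply: (@intr_inj rat); rewrite !intrM -xd numqE mulrC.
  by rewrite mulrA (mulrC d%:~R).
have dE (x : rat) : x * (denq x)%:~R = (numq x)%:~R by rewrite -numqE.
have ratrB : zmod_morphism (@ratr F).
  move=> x y.
  rewrite (fracE _ (numq x * denq y - numq y * denq x) (denq x * denq y)).
  - rewrite [ratr x]/ratr [ratr y]/ratr intrB !intrM.
    by field; rewrite !nz_den.
  - by rewrite mulf_neq0 ?denq_eq0.
  - by rewrite rmorphB !rmorphM /= -!dE mulrBl; congr (_ - _); rewrite !mulrA // mulrAC.
have ratrM : monoid_morphism (@ratr F).
  split=> [|x y]; first by rewrite /ratr divr1.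
  rewrite (fracE _ (numq x * numq y) (denq x * denq y)).
  - by rewrite !rmorphM /= mulf_div.
  - by rewrite mulf_neq0 ?denq_eq0.
  - by rewrite !rmorphM /= -!dE mulrACA.
pose fB := GRing.isZmodMorphism.Build rat F (@ratr F) ratrB.
pose fM := GRing.isMonoidMorphism.Build rat F (@ratr F) ratrM.
pose iota : {rmorphism rat -> F} := HB.pack (@ratr F) fB fM.
by exists iota.
Qed.

(** The abstract number field is Q[X] / (p), embedded in F by X |-> y. *)
Lemma generates_irreducible (F : fieldType) (iota : {rmorphism rat -> F})
    (p G : {poly rat}) (y : F) :
  irreducible_poly p -> root (map_poly iota p) y ->
  generates_number_field [:: (map_poly iota G).[y]; y] (size p).-1.
Proof.
move=> irr_p py0.
have nz_p := irredp_neq0 irr_p.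
pose K : fieldExtType rat := SubFieldExtType py0 irr_p.
have phiK := subfx_inj_eval py0 nz_p.
have phi_root := subfx_inj_root py0 nz_p.
have phi_base := subfx_inj_base py0 nz_p.
pose th : K := subfx_root iota y p.
pose phi : {rmorphism K -> F} := @subfx_inj _ _ iota y p.
have phiG : phi (map_poly (in_alg K) G).[th] = (map_poly iota G).[y].
  rewrite -horner_map /= -map_poly_comp phi_root.
  by congr (_.[y]); apply: eq_map_poly => b /=; apply: phi_base.
exists K, phi, [:: (map_poly (in_alg K) G).[th]; th]; split.
- by rewrite /= phiG phi_root.
- apply/vspaceP => x; rewrite memvf.
  have [q ->] := subfxEroot py0 nz_p x.
  apply: rpred_horner.
    by apply/polyOverP=> i; rewrite coef_map; apply: rpredZ; apply: rpred1.
  by apply: seqv_sub_adjoin; rewrite !inE eqxx orbT.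
- by rewrite dimvf.
Qed.

(** Since Z passes from a product to one of the factors, a factor of least
    degree among those satisfying Z is irreducible.  It is used with Z the
    property of having a given root, and with Z the property of being
    nonconstant. *)
Lemma irreducible_factor_where (F : fieldType) (Z : pred {poly F}) (p : {poly F}) :
  (forall q, q != 0 -> Z q -> (1 < size q)%N) ->
  (forall q r, Z (q * r) -> Z q || Z r) ->
  p != 0 -> Z p -> exists q : {poly F}, [/\ irreducible_poly q, q %| p & Z q].
Proof.
move=> Zsize ZM.
have [d] := ubnP (size p); elim: d p => // d IHd p; rewrite ltnS => led nz_p Zp.
have [[q [szq qp nqp]]|irr] := boolp.pselect
    (exists q : {poly F}, [/\ size q != 1%N, q %| p & ~~ (q %= p)]); last first.
  exists p; split=> //; split=> [|q szq qp]; first exact: Zsize.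
  by apply: contraPT irr => nqp; case; exists q.
have [r Dp] := dvdpP _ _ qp.
have : Z (r * q) by rewrite -Dp.
have [nz_r nz_q] : r != 0 /\ q != 0 by apply/norP; rewrite -mulf_eq0 -Dp.
have ltq : (size q < size p)%N.
  by rewrite ltn_neqAle dvdp_leq // andbT dvdp_size_eqp.
have ltr : (size r < size p)%N.
  have q1 : (1 < size q)%N by rewrite ltn_neqAle eq_sym szq size_poly_gt0.
  rewrite Dp size_mul // -subn1 -addnBA; last exact: ltnW.
  by rewrite -[X in (X < _)%N]addn0 ltn_add2l subn_gt0.
move=> /ZM/orP[] Zf.
  have [s [? sr ?]] := IHd r (leq_trans ltr led) nz_r Zf.
  by exists s; split=> //; rewrite Dp dvdp_mulr.
have [s [? sr ?]] := IHd q (leq_trans ltq led) nz_q Zf.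
by exists s; split=> //; rewrite Dp dvdp_mull.
Qed.

(** The irreducible factor of p that vanishes at y takes the role of the
    minimal polynomial of y. *)
Lemma generates_root (F : fieldType) (iota : {rmorphism rat -> F})
    (p G : {poly rat}) (y : F) :
  p != 0 -> root (map_poly iota p) y ->
  exists2 n : nat, (n <= (size p).-1)%N &
    generates_number_field [:: (map_poly iota G).[y]; y] n.
Proof.
move=> nz_p py0.
have [||q [irr_q qp qy]] := irreducible_factor_where
    (Z := fun q => root (map_poly iota q) y) _ _ nz_p py0.
- by move=> q nz_q qy; rewrite -(size_map_poly iota) (root_size_gt1 _ qy) ?map_poly_eq0.
- by move=> q r; rewrite rmorphM rootM.
exists (size q).-1; last exact: generates_irreducible.
by rewrite -!subn1 leq_sub2r // dvdp_leq.
Qed.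

(** * Specialisation of relations between roots *)

Lemma mpoly_rmorph_ext (n : nat) (R S : comNzRingType)
    (f g : {rmorphism {mpoly R[n]} -> S}) :
  (forall c, f c%:MP = g c%:MP) -> (forall i, f 'X_i = g 'X_i) -> f =1 g.
Proof.
move=> fgC fgX p; rewrite (mpolyE p) !rmorph_sum; apply: eq_bigr => m _.
rewrite -mul_mpolyC !rmorphM fgC mpolyXE_id !rmorph_prod; congr (_ * _).
by apply: eq_bigr => i _; rewrite !rmorphXn fgX.
Qed.

Lemma mmap_msym (n : nat) (R S : comNzRingType) (phi : {rmorphism R -> S})
    (r : 'I_n -> S) (s : 'S_n) (Q : {mpoly R[n]}) :
  mmap phi r (msym s Q) = mmap phi (fun i => r (s i)) Q.
Proof.
apply: (@mpoly_rmorph_ext n R S (mmap phi r \o msym s) (mmap phi (fun i => r (s i)))).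
- by move=> c; rewrite /= /msym !mmapC.
- by move=> i; rewrite /= /msym !mmapX !mmap1U mmapX mmap1U.
Qed.

(** A symmetric polynomial is a polynomial in the elementary symmetric ones,
    and these take the signed coefficients of P as values at the roots.  So the
    value c is computed inside A, whatever the field in which P splits. *)
Lemma symmetric_root_value (A : comNzRingType) (n : nat) (P : {poly A})
    (F : {mpoly A[n]}) : F \is symmetric ->
  {c : A | forall (L : fieldType) (phi : {rmorphism A -> L}) (r : 'I_n -> L),
    map_poly phi P = \prod_(i < n) ('X - (r i)%:P) -> mmap phi r F = phi c}.
Proof.
move=> /sym_fundamental[t [<- _]].
pose v (i : 'I_n) : A := (-1) ^+ i.+1 * P`_(n - i.+1).
exists t.@[v] => L phi r Pr.
pose S := [tuple mesym n A i.+1 | i < n].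
apply: (@mpoly_rmorph_ext n A L (mmap phi r \o comp_mpoly S) (phi \o meval v)).
- by move=> c; rewrite /= comp_mpolyC mmapC mevalC.
- move=> i; rewrite /= comp_mpolyXU mevalXU -tnth_nth tnth_mktuple.
  have -> : mmap phi r (mesym n A i.+1) = (mesym n L i.+1).@[r].
    rewrite /mesym !rmorph_sum /=; apply: eq_bigr => h _.
    rewrite !rmorph_prod /=; apply: eq_bigr => j _.
    by rewrite mmapX mmap1U mevalXU.
  have lti : (i.+1 < n.+1)%N by rewrite ltnS.
  have := mroots_coeff [tuple r i | i < n] (Ordinal lti).
  rewrite big_tuple (eq_bigr (fun i => 'X - (r i)%:P)); last first.
    by move=> j _; rewrite tnth_mktuple.
  rewrite -Pr coef_map /= rmorphM rmorphXn rmorphN1 => ->.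
  rewrite mulrA -signr_odd -signr_addb addbb mul1r.
  by apply: meval_eq => j; rewrite tnth_mktuple.
Qed.

(** The coefficients of N(X) = prod_s (X - Q(x_(s 1), ..., x_(s n))) are
    symmetric, so their values at the roots of P come from elements of A.  Over
    L the relation makes N equal to X^k; as phi is injective, N is also X^k
    over M, where the value of Q is a root of N.  This takes the place of
    extending the specialisation of A to a place of the splitting field. *)
Lemma root_relation_specializes (A : comNzRingType) (n : nat) (P : {poly A})
    (L M : fieldType) (phi : {rmorphism A -> L}) (psi : {rmorphism A -> M})
    (r : 'I_n -> L) (rho : 'I_n -> M) (Q : {mpoly A[n]}) :
  injective phi ->
  map_poly phi P = \prod_(i < n) ('X - (r i)%:P) ->
  map_poly psi P = \prod_(i < n) ('X - (rho i)%:P) ->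
  (forall s : 'S_n, mmap phi (fun i => r (s i)) Q = 0) ->
  mmap psi rho Q = 0.
Proof.
move=> inj_phi Pr Prho Qr.
pose N : {poly {mpoly A[n]}} := \prod_(s : 'S_n) ('X - (msym s Q)%:P).
pose k := #|{: 'S_n}|.
have mapN (K : fieldType) (th : {rmorphism A -> K}) (x : 'I_n -> K) :
    map_poly (mmap th x) N
    = \prod_(s : 'S_n) ('X - (mmap th (fun i => x (s i)) Q)%:P).
  rewrite rmorph_prod; apply: eq_bigr => s _.
  by rewrite rmorphB /= map_polyX map_polyC /= mmap_msym.
have symN i : N`_i \is symmetric.
  apply/issymP => s; rewrite -[LHS]coef_map.
  suff -> : map_poly (msym s) N = N by [].
  rewrite rmorph_prod [RHS](reindex_inj (mulIg s)) /=; apply: eq_bigr => u _.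
  by rewrite rmorphB /= map_polyX map_polyC /= msymMm.
have Nr : map_poly (mmap phi r) N = 'X^k.
  rewrite mapN (eq_bigr (fun=> 'X)) ?prodr_const // => s _.
  by rewrite Qr subr0.
have Nrho : map_poly (mmap psi rho) N = 'X^k.
  apply/polyP => i; have [c cE] := symmetric_root_value P (symN i).
  have := congr1 (fun p : {poly L} => p`_i) Nr.
  rewrite !coef_map /= (cE _ _ _ Pr) (cE _ _ _ Prho) !coefXn.
  by rewrite -(rmorph_nat phi) => /inj_phi ->; rewrite rmorph_nat.
have /eqP : (map_poly (mmap psi rho) N).[mmap psi rho Q] = 0.
  rewrite mapN horner_prod (bigD1 1%g) //= !hornerE.
  suff -> : mmap psi (fun i => rho ((1%g : 'S_n) i)) Q = mmap psi rho Q.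
    by rewrite subrr mul0r.
  by rewrite -mmap_msym msym1m.
by rewrite Nrho hornerXn expf_eq0 => /andP[_ /eqP].
Qed.

(** * Splitting fields *)

(** Adjoin a root of an irreducible factor, divide by the corresponding linear
    factor, and repeat.  The field that contains the coefficients grows, while
    the base F0 over which all the extensions are finite stays the same. *)
Lemma splitting_tower (F0 : fieldType) (L : fieldExtType F0) (p : {poly L}) :
  p \is monic ->
  exists (M : fieldExtType F0) (f : {rmorphism L -> M}),
    (forall a : F0, f a%:A = a%:A) /\
    exists rs : seq M, map_poly f p = \prod_(z <- rs) ('X - z%:P).
Proof.
have [d] := ubnP (size p); elim: d L p => // d IHd L p; rewrite ltnS => led mon_p.
have nz_p := monic_neq0 mon_p.
have [p1|p_gt1] := leqP (size p) 1.
  exists L, idfun; split=> //; exists [::].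
  rewrite map_poly_id // big_nil; apply/eqP; rewrite -eqp_monic ?monic1 //.
  by rewrite -size_poly_eq1 eqn_leq p1 size_poly_gt0.
have [||q [irr_q qp _]] :=
  irreducible_factor_where (Z := fun q : {poly L} => (1 < size q)%N) _ _ nz_p p_gt1.
- by [].
- move=> q r; apply: contraLR; rewrite negb_or -!leqNgt => /andP[q1 r1].
  by apply: leq_trans (size_polyMleq _ _) _; rewrite -subn1 leq_subLR (leq_add q1 r1).
have [M1 _ [z qz _]] := irredp_FAdjoin irr_q.
pose M0 : fieldExtType F0 := baseFieldType M1.
pose g : {rmorphism L -> M0} := in_alg M1.
have /factor_theorem[r Dr] : root (map_poly g p) z.
  by have [u ->] := dvdpP _ _ qp; rewrite rmorphM rootM [X in _ || X]qz orbT.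
have mon_r : r \is monic.
  by rewrite -(monicMr _ (monicXsubC z)) -Dr monic_map.
have ltr : (size r < d)%N.
  apply: leq_trans led; rewrite -(size_map_poly g p) Dr.
  by rewrite size_monicM ?monicXsubC ?polyXsubC_eq0 ?size_XsubC ?addn2 //=
     -size_poly_eq0 size_XsubC.
have [M [f [fA [rs Drs]]]] := IHd M0 r ltr mon_r.
exists M, (f \o g); split.
  move=> a /=; rewrite -fA; congr (f _).
exists (f z :: rs); rewrite big_cons map_poly_comp Dr rmorphM rmorphB /=.
by rewrite map_polyX map_polyC /= Drs mulrC.
Qed.

Lemma splitting_field_over (F0 : fieldType) (p : {poly F0}) : p \is monic ->
  exists (L : fieldExtType F0) (r : 'I_(size p).-1 -> L),
    map_poly (in_alg L) p = \prod_i ('X - (r i)%:P).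
Proof.
move=> mon_p; pose F1 : fieldExtType F0 := F0^o.
have [L [f [fA [rs Drs]]]] := splitting_tower (L := F1) (p := p) mon_p.
have Dp : map_poly (in_alg L) p = \prod_(z <- rs) ('X - z%:P).
  rewrite -Drs; apply: eq_map_poly => a /=; rewrite -fA; congr (f _).
  by rewrite /GRing.scale /= mulr1.
have szr : size rs = (size p).-1.
  by rewrite -(size_map_poly (in_alg L)) Dp size_prod_XsubC.
exists L, (fun i => rs`_i); rewrite Dp (big_nth 0) szr big_mkord.
by [].
Qed.

(** * Thin sets attached to an irrational element *)

Lemma fraction_denominator (A : idomainType) (x : {fraction A}) :
  exists2 d : A, d != 0 & exists n : A, tofrac d * x = tofrac n.
Proof.
elim/quotW: x => r; exists \d_r; first exact: denom_ratioP.
exists \n_r; unlock tofrac; rewrite -[LHS]FracField.pi_mul.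
apply/eqmodP => /=; rewrite FracField.equivfE /FracField.mulf /=.
by rewrite !numden_Ratio ?mulf_neq0 ?oner_eq0 ?denom_ratioP // !(mul1r, mulr1).
Qed.

Lemma fraction_common_denominator (A : idomainType) (k : nat)
    (c : 'I_k -> {fraction A}) :
  exists2 d : A, d != 0 &
    exists n : 'I_k -> A, forall i, tofrac d * c i = tofrac (n i).
Proof.
have /boolp.choice[e eP] : forall i, exists e : A * A,
    e.1 != 0 /\ tofrac e.1 * c i = tofrac e.2.
  by move=> i; have [d nz_d [n dn]] := fraction_denominator (c i); exists (d, n).
exists (\prod_i (e i).1); first by apply/prodf_neq0 => i _; case: (eP i).
exists (fun i => (\prod_(j | j != i) (e j).1) * (e i).2) => i.
by rewrite (bigD1 i) //= !rmorphM mulrAC (eP i).2 mulrC.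
Qed.

Lemma poly_common_denominator (A : idomainType) (g : {poly {fraction A}}) :
  exists2 d : A, d != 0 &
    exists g1 : {poly A}, tofrac d *: g = map_poly (@tofrac A) g1.
Proof.
have [d nz_d [n dn]] := fraction_common_denominator (fun i : 'I_(size g) => g`_i).
exists d => //; exists (\poly_(i < size g) if insub i is Some j then n j else 0).
apply/polyP=> i; rewrite coefZ coef_map coef_poly /=.
case: ltnP => [lti|lei]; first by rewrite insubT -dn.
by rewrite nth_default // mulr0 rmorph0.
Qed.

Definition extend_last (m : nat) (T : Type) (x : 'I_m -> T) (z : T)
  (i : 'I_m.+1) : T := oapp x z (unlift ord_max i).

(** The projection of the affine space of dimension m + 1 that forgets the last
    coordinate. *)
Definition coord_ext (m : nat) : m.-tuple {mpoly rat[m.+1]} :=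
  [tuple 'X_(lift ord_max i) | i < m].

Section RationalPoints.
Variables (m : nat) (L : fieldExtType {fraction {mpoly rat[m]}}).
Local Notation A := {mpoly rat[m]}.

Definition generic_point : {rmorphism A -> L} := in_alg L \o @tofrac A.

Lemma generic_point_inj : injective generic_point.
Proof. by move=> p q /= /(fmorph_inj (in_alg L))/eqP; rewrite tofrac_eq => /eqP. Qed.

(** The point (T_1, ..., T_m, beta) with coordinates in L.  Its kernel is the
    prime ideal of a variety with function field Q(T_1, ..., T_m)(beta). *)
Definition extended_point (beta : L) : {rmorphism {mpoly rat[m.+1]} -> L} :=
  mmap (generic_point \o @mpolyC m rat)
       (extend_last (fun i => generic_point 'X_i) beta).

Lemma extended_point_coord beta (q : A) :
  extended_point beta (q \mPo coord_ext m) = generic_point q.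
Proof.
apply: (@mpoly_rmorph_ext m rat L (extended_point beta \o comp_mpoly (coord_ext m)) generic_point).
- by move=> c; rewrite /= comp_mpolyC mmapC.
- move=> i; rewrite /= comp_mpolyXU -tnth_nth tnth_mktuple mmapX mmap1U.
  by rewrite /extend_last liftK.
Qed.

(** The variety is the closure of the point (T_1, ..., T_m, beta), projected to
    the first m coordinates.  The projection is dominant because the T_i are
    independent.  Its degree is at most [L : Q(T)], and at least 2 because 1 and
    beta are independent over Q(T). *)
Lemma thin_C2_irrational_element (beta : L) :
  (forall x, beta <> x%:A) ->
  thin_C2 [set a : m.-tuple rat | exists z : rat, forall p,
    extended_point beta p = 0 -> p.@[extend_last (tnth a) z] = 0]%classic.
Proof.
move=> beta_irr.
pose P : {pred {mpoly rat[m.+1]}} := [pred p | extended_point beta p == 0].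
have PE p : (p \in P) = (extended_point beta p == 0) by [].
pose has_free k := boolp.asbool (exists u : k.-tuple {mpoly rat[m.+1]},
  function_field_free P (coord_ext m) u).
have free_dim k : has_free k -> (k <= \dim {:L})%N.
  move=> /boolp.asboolP[u uP].
  pose X := [tuple extended_point beta (tnth u i) | i < k].
  suff /eqP freeX : free X by rewrite -(size_tuple X) -freeX dimvS ?subvf.
  apply/freeP => c; have [d nz_d [n dn]] := fraction_common_denominator c.
  move=> cX i; apply/eqP; rewrite -(mulrI_eq0 _ (mulfI (_ : tofrac d != 0))) ?tofrac_eq0 //.
  rewrite dn tofrac_eq0 (uP n) // PE rmorph_sum /=.
  rewrite (eq_bigr (fun i => generic_point d * (c i *: X`_i))); last first.
    move=> j _; rewrite rmorphM /= extended_point_coord /= -dn.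
    by rewrite nth_mktuple -!scalerAl !mul1r scalerA.
  by rewrite -mulr_sumr cX mulr0.
have free2 : has_free 2%N.
  apply/boolp.asboolP; exists [tuple 1; 'X_ord_max] => a.
  rewrite PE !big_ord_recl big_ord0 addr0 rmorphD !rmorphM /=.
  rewrite !extended_point_coord !(tnth_nth 0) /= rmorph1 mulr1.
  rewrite mmapX mmap1U /extend_last unlift_none /= => /eqP aP.
  set a0 := a ord0 in aP; set a1 := a (lift ord0 ord0) in aP.
  have [a10|nz_a1] := eqVneq a1 0.
    move: aP; rewrite a10 rmorph0 !scale0r mul0r addr0 => /eqP.
    rewrite scaler_eq0 oner_eq0 orbF tofrac_eq0 => /eqP a00.
    by case=> [[|[|//]]] lti; [rewrite -a00|rewrite -a10]; congr a; apply: val_inj.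
  case: (beta_irr (- (tofrac a0 / tofrac a1))).
  have nz : tofrac a1 != 0 by rewrite tofrac_eq0.
  apply: (scalerI nz); rewrite scalerA mulrN mulrC divfK // scaleNr.
  by apply/eqP; rewrite -addr_eq0 addrC -{1}[beta]mul1r scalerAl aP.
have [k freek kmax] := ex_maxnP (ex_intro _ 2%N free2) free_dim.
exists m.+1, P, (coord_ext m), k; split.
- split; first split.
  + by rewrite PE rmorph0.
  + by rewrite PE rmorph1 oner_eq0.
  + move=> a u v; rewrite !PE rmorphD rmorphM => /eqP -> /eqP ->.
    by rewrite mulr0 addr0.
  + by move=> u v; rewrite !PE rmorphM mulf_eq0.
- move=> q; rewrite PE extended_point_coord => /eqP.
  by rewrite -(rmorph0 generic_point) => /generic_point_inj.
- split; first exact: kmax.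
  split; first exact/boolp.asboolP.
  move=> u uP; suff /kmax : has_free k.+1 by rewrite ltnn.
  by apply/boolp.asboolP; exists u.
- move=> a [z zP]; exists [tuple extend_last (tnth a) z i | i < m.+1]; split.
    move=> p; rewrite PE => /eqP /zP <-.
    by apply: meval_eq => i; rewrite tnth_mktuple.
  move=> i; rewrite tnth_mktuple mevalXU tnth_mktuple.
  by rewrite /extend_last liftK.
Qed.

End RationalPoints.

(** * The set of reducible specialisations is thin *)

Definition specialize (m : nat) (a : m.-tuple rat) (P : {poly {mpoly rat[m]}}) :
  {poly rat} := map_poly (meval (tnth a)) P.

(** The points with an irreducible specialisation are Zariski dense. *)
Definition generically_irreducible (m : nat) (P : {poly {mpoly rat[m]}}) : Prop :=
  forall q : {mpoly rat[m]}, q != 0 ->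
  exists a : m.-tuple rat, q.@[tnth a] != 0 /\ irreducible_poly (specialize a P).

(** After clearing denominators, a factorisation over Q(T) can be specialised
    at a point where P is irreducible and neither a denominator nor a leading
    coefficient vanishes; so P is irreducible over Q(T). *)
Lemma generically_irreducible_generic_factor (m : nat)
    (P : {poly {mpoly rat[m]}}) (g : {poly {fraction {mpoly rat[m]}}}) :
  P \is monic -> generically_irreducible P ->
  g %| map_poly (@tofrac {mpoly rat[m]}) P -> (1 < size g)%N ->
  size g = size P.
Proof.
move=> monP irrP /dvdpP[h Ph] g_gt1.
have [d nz_d [g1 Dg1]] := poly_common_denominator g.
have [e nz_e [h1 Dh1]] := poly_common_denominator h.
have Dgh : (e * d) *: P = h1 * g1.
  apply: (map_inj_poly (f := @tofrac {mpoly rat[m]})).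
  - by move=> x y /eqP; rewrite tofrac_eq => /eqP.
  - exact: tofrac0.
  by rewrite map_polyZ [in RHS]rmorphM /= -Dg1 -Dh1 -scalerAl -scalerAr scalerA -tofracM Ph.
have szg1 : size g1 = size g.
  rewrite -(size_scale g (_ : tofrac d != 0)) ?tofrac_eq0 // Dg1.
  by rewrite size_map_inj_poly ?tofrac0 // => x y /eqP; rewrite tofrac_eq => /eqP.
have nz_l : lead_coef g1 != 0 by rewrite lead_coef_eq0 -size_poly_gt0 szg1 ltnW.
have [|a [qa [_ irr]]] := irrP (e * d * lead_coef g1).
  by rewrite !mulf_neq0.
rewrite !mevalM !mulf_eq0 !negb_or in qa; case/andP: qa => nz_ed nz_la.
have szga : size (specialize a g1) = size g1.
  exact: size_map_poly_id0.
have szPa : size (specialize a P) = size P.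
  by rewrite /specialize size_map_poly_id0 // (monicP monP) meval1 oner_eq0.
have := congr1 (specialize a) Dgh.
rewrite /specialize map_polyZ [in RHS]rmorphM /= mevalM => Da.
have : specialize a g1 %| specialize a P.
  rewrite -(dvdpZr _ _ (_ : e.@[tnth a] * d.@[tnth a] != 0)) ?mulf_eq0 ?negb_or //.
  by rewrite Da dvdp_mull.
move/irr; rewrite szga szg1 -szPa => /(_ _)/eqp_size.
by rewrite szga szg1; apply; rewrite neq_ltn g_gt1 orbT.
Qed.

Lemma thin_cover (m : nat) (I : finType) (B : I -> set (m.-tuple rat))
    (E : set (m.-tuple rat)) :
  (forall i, thin_C1 (B i) \/ thin_C2 (B i)) ->
  (forall a, E a -> exists i, B i a) -> thin E.
Proof.
move=> thinB EB; exists #|I|, (fun j => B (enum_val j)); split=> [j|a /EB[i Bia]].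
  exact: thinB.
by exists (enum_rank i); rewrite enum_rankK.
Qed.

(** With r composed with a permutation, the product of X - r_i over any set
    of k indices has this form. *)
Definition partial_product (n : nat) (T : nzRingType) (k : nat) (r : 'I_n -> T) :
  {poly T} := \prod_(i < n | (i < k)%N) ('X - (r i)%:P).

Lemma map_partial_product (n : nat) (S T : comNzRingType) (f : {rmorphism S -> T})
    (k : nat) (r : 'I_n -> S) :
  map_poly f (partial_product k r) = partial_product k (f \o r).
Proof.
rewrite rmorph_prod; apply: eq_bigr => i _.
by rewrite rmorphB /= map_polyX map_polyC.
Qed.

Lemma size_partial_product (n k : nat) (T : idomainType) (r : 'I_n -> T) :
  (k <= n)%N -> size (partial_product k r) = k.+1.
Proof.
move=> lekn; rewrite /partial_product size_prod; last first.
  by move=> i _; rewrite polyXsubC_eq0.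
rewrite (eq_bigr (fun=> 2%N)) => [|i _]; last by rewrite size_XsubC.
rewrite sum_nat_const.
have -> : #|(fun i : 'I_n => (i < k)%N)| = k; last by rewrite muln2 -addnn subSn ?addnK ?leq_addr.
rewrite -sum1_card (eq_bigl (fun i : 'I_n => (i < k)%N)) //.
by rewrite (big_ord_narrow lekn) sum1_card card_ord.
Qed.

Lemma partial_product_dvd (n k : nat) (T : fieldType) (r : 'I_n -> T)
    (s : 'S_n) :
  partial_product k (r \o s) %| \prod_i ('X - (r i)%:P).
Proof.
rewrite (reindex_inj (@perm_inj _ s)) /=.
rewrite [X in _ %| X](bigID (fun i : 'I_n => (i < k)%N)) /=.
exact: dvdp_mulIl.
Qed.

(** If all the coefficients were in Q(T), the product would be a proper factor
    of P over Q(T). *)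
Lemma partial_product_irrational (m n k : nat) (P : {poly {mpoly rat[m]}})
    (L : fieldExtType {fraction {mpoly rat[m]}}) (r : 'I_n -> L) (s : 'S_n) :
  P \is monic -> generically_irreducible P ->
  map_poly (generic_point L) P = \prod_i ('X - (r i)%:P) ->
  (0 < k < n)%N ->
  exists j, forall x, (partial_product k (r \o s))`_j <> x%:A.
Proof.
move=> monP irrP Pr /andP[k_gt0 ltkn]; apply: boolp.contrapT => rational.
have /boolp.choice[c cE] : forall j, exists x : {fraction {mpoly rat[m]}},
    (partial_product k (r \o s))`_j = x%:A.
  by move=> j; apply: boolp.contrapT => nx; apply: rational; exists j => x xE; apply: nx; exists x.
pose g := \poly_(j < k.+1) c j.
have Dg : map_poly (in_alg L) g = partial_product k (r \o s).
  apply/polyP => j; rewrite coef_map coef_poly /=; case: ltnP => [_|lekj].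
    by rewrite cE.
  by rewrite scale0r nth_default // size_partial_product // ltnW.
have szg : size g = k.+1.
  by rewrite -(size_map_poly (in_alg L)) Dg size_partial_product // ltnW.
have : size g = size P.
  apply: generically_irreducible_generic_factor => //; last by rewrite szg.
  rewrite -(dvdp_map (in_alg L)) Dg -map_poly_comp.
  by rewrite (eq_map_poly (g := generic_point L)) // Pr partial_product_dvd.
rewrite szg -(size_map_inj_poly (@generic_point_inj m L)) ?rmorph0 //.
rewrite Pr size_prod_XsubC.
by rewrite -[index_enum _]enumT size_enum_ord => -[kn]; rewrite kn ltnn in ltkn.
Qed.

(** For each ordering s of the roots and each k, let beta be a coefficient
    outside Q(T) of the product over the first k roots, and let B be the set of
    type (C2) on which beta specialises to a rational number.  Suppose that the
    specialisation at a has a rational factor of degree k but that a is in none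
    of the sets B.  Then for every s some polynomial p_s vanishes at (T, beta)
    and not at (a, z), where z is the corresponding coefficient of the rational
    factor.  The product of the p_s, written in the roots, vanishes for every
    ordering of the generic roots, hence at the roots of the specialisation
    listed so that those of the rational factor come first.  But there all its
    factors are nonzero. *)
Lemma thin_reducible_monic (m : nat) (P : {poly {mpoly rat[m]}}) :
  P \is monic -> generically_irreducible P ->
  thin [set a | ~ irreducible_poly (specialize a P)]%classic.
Proof.
move=> monP irrP; pose A := {mpoly rat[m]}; pose n := (size P).-1.
have monPF : map_poly (@tofrac A) P \is monic by apply: monic_map.
have szPF : size (map_poly (@tofrac A) P) = size P.
  by rewrite size_map_inj_poly ?tofrac0 // => x y /eqP; rewrite tofrac_eq => /eqP.
have := splitting_field_over monPF; rewrite szPF -/n => -[L [r Pr0]].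
have Pr : map_poly (generic_point L) P = \prod_i ('X - (r i)%:P).
  by rewrite -Pr0 -map_poly_comp.
have /boolp.choice[j jP] : forall x : 'S_n * 'I_n, exists j, (0 < x.2)%N ->
    forall y, (partial_product x.2 (r \o x.1))`_j <> y%:A.
  case=> s k /=; have [k0|k_gt0] := posnP k; first by exists 0%N; rewrite k0.
  have [|j jE] := @partial_product_irrational m n k P L r s monP irrP Pr.
    by rewrite k_gt0 ltn_ord.
  by exists j.
pose beta (x : 'S_n * 'I_n) := (partial_product x.2 (r \o x.1))`_(j x).
pose B (x : 'S_n * 'I_n) : set (m.-tuple rat) := [set a | (0 < x.2)%N /\
  exists z : rat, forall p, extended_point (beta x) p = 0 ->
    p.@[extend_last (tnth a) z] = 0]%classic.
apply: (@thin_cover m _ B) => [x|a].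
  have [x0|x_gt0] := posnP x.2.
    left; exists 1; first exact: oner_neq0.
    by move=> a [] /=; rewrite x0.
  right; have [m' [Q [pi [k [HQ Hpi Hk HE]]]]] := thin_C2_irrational_element (jP x x_gt0).
  by exists m', Q, pi, k; split=> // a [_ /HE].
move=> /= red_a; apply: boolp.contrapT => notB.
pose ev : {rmorphism A -> algC} := ratr \o meval (tnth a).
have monPa : specialize a P \is monic by apply: monic_map.
have szPa : size (specialize a P) = n.+1.
  rewrite size_map_poly_id0 ?(monicP monP) ?meval1 ?oner_eq0 //.
  by rewrite -polySpred // monic_neq0.
have n_gt0 : (0 < n)%N.
  have [b [_ [szb _]]] := irrP 1 (oner_neq0 _).
  move: szb; rewrite size_map_poly_id0 ?(monicP monP) ?meval1 ?oner_eq0 //.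
  by rewrite polySpred ?monic_neq0.
have [g [szg gP ngP]] : exists g : {poly rat},
    [/\ size g != 1%N, g %| specialize a P & ~~ (g %= specialize a P)].
  apply: boolp.contrapT => irr; apply: red_a; split=> [|g szg gP]; first by rewrite szPa.
  by apply: contraPT irr => ngP; case; exists g.
have nz_g : g != 0 by apply: contraTneq gP => ->; rewrite dvd0p monic_neq0.
pose g0 := (lead_coef g)^-1 *: g.
have nz_lg : (lead_coef g)^-1 != 0 by rewrite invr_eq0 lead_coef_eq0.
have mon_g0 : g0 \is monic by rewrite monicE lead_coefZ mulVf // lead_coef_eq0.
have szg0 : size g0 = size g by rewrite size_scale.
have /dvdpP[h0 Dh0] : g0 %| specialize a P by rewrite dvdpZl.
have mon_h0 : h0 \is monic by rewrite -(monicMr _ mon_g0) -Dh0.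
pose k := (size g).-1.
have [rs1 Drs1] := closed_field_poly_normal (map_poly (ratr : rat -> algC) g0).
have [rs2 Drs2] := closed_field_poly_normal (map_poly (ratr : rat -> algC) h0).
rewrite lead_coef_map (monicP mon_g0) rmorph1 scale1r in Drs1.
rewrite lead_coef_map (monicP mon_h0) rmorph1 scale1r in Drs2.
have szrs1 : size rs1 = k.
  by rewrite /k -szg0 -(size_map_poly (ratr : {rmorphism rat -> algC})) Drs1 size_prod_XsubC.
(* The roots of the rational factor come first, so that it is the partial
   product of the first k linear factors. *)
pose rho (i : 'I_n) := (rs1 ++ rs2)`_i.
have DPa : map_poly ev P = \prod_(z <- rs1 ++ rs2) ('X - z%:P).
  by rewrite big_cat /= -Drs1 -Drs2 mulrC -rmorphM -Dh0 /specialize /= -map_poly_comp.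
have szrs : size (rs1 ++ rs2) = n.
  have : size (map_poly ev P) = size (specialize a P).
    by rewrite -[RHS](size_map_poly (ratr : {rmorphism rat -> algC})) /specialize -map_poly_comp.
  by rewrite DPa size_prod_XsubC szPa => -[].
have Prho : map_poly ev P = \prod_i ('X - (rho i)%:P).
  by rewrite DPa (big_nth 0) szrs big_mkord.
have ltkn : (k < n)%N.
  have := dvdp_leq (monic_neq0 monPa) gP; rewrite leq_eqVlt.
  case/predU1P => [szE|]; first by rewrite -(dvdp_size_eqp gP) szE eqxx in ngP.
  by rewrite szPa ltnS /k; case: (size g) (nz_g) => // /=; rewrite -size_poly_eq0.
have k_gt0 : (0 < k)%N.
  have : (1 < size g)%N by rewrite ltn_neqAle eq_sym szg size_poly_gt0.
  by rewrite /k; case: (size g) => [|[|]].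
pose x (s : 'S_n) : 'S_n * 'I_n := (s, Ordinal ltkn).
have /boolp.choice[p pP] : forall s : 'S_n, exists p : {mpoly rat[m.+1]},
    extended_point (beta (x s)) p = 0 /\
    p.@[extend_last (tnth a) g0`_(j (x s))] != 0.
  move=> s; apply: boolp.contrapT => np; apply: notB; exists (x s); split=> //.
  exists g0`_(j (x s)) => p p0; apply/eqP; apply: boolp.contrapT => /negP pz.
  by apply: np; exists p.
pose G : {poly {mpoly A[n]}} := partial_product k (fun i : 'I_n => 'X_i).
pose sub (s : 'S_n) : {rmorphism {mpoly rat[m.+1]} -> {mpoly A[n]}} :=
  mmap (@mpolyC n A \o @mpolyC m rat)
    (extend_last (fun i : 'I_m => ('X_i : A)%:MP) G`_(j (x s))).
(* The relation p_s, with beta written as a polynomial in the roots. *)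
pose Q : {mpoly A[n]} := \prod_s sub s (p s).
have mapG (K : fieldType) (th : {rmorphism A -> K}) (y : 'I_n -> K) i :
    mmap th y G`_i = (partial_product k y)`_i.
  rewrite -[LHS]coef_map map_partial_product.
  suff -> : partial_product k (mmap th y \o (fun u => 'X_u)) = partial_product k y by [].
  by apply: eq_bigr => u _; rewrite /= mmapX mmap1U.
have subE (K : fieldType) (th : {rmorphism A -> K}) (y : 'I_n -> K) s q :
    mmap th y (sub s q) = mmap (th \o @mpolyC m rat)
      (extend_last (fun i : 'I_m => th 'X_i) (partial_product k y)`_(j (x s))) q.
  apply: (@mpoly_rmorph_ext _ _ K (mmap th y \o sub s) (mmap _ _)).
  - by move=> c; rewrite /= !mmapC.
  - move=> i; rewrite /= !mmapX !mmap1U /extend_last.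
    by case: (unlift ord_max i) => [u|] /=; rewrite ?mmapC ?mapG.
have : mmap ev rho Q = 0.
  apply: (root_relation_specializes (@generic_point_inj m L) Pr Prho) => s.
  rewrite rmorph_prod (bigD1 s isT).
  have := etrans (subE _ (generic_point L) (fun i => r (s i)) s (p s)) (pP s).1.
  move=> Es; apply: etrans (congr1 (fun c => c * _) Es) _.
  exact: mul0r.
apply/eqP; rewrite rmorph_prod; apply/prodf_neq0 => s _.
have Prs1 : partial_product k rho = map_poly (ratr : {rmorphism rat -> algC}) g0.
  rewrite Drs1 (big_nth 0) szrs1 big_mkord /partial_product.
  rewrite (big_ord_narrow (ltnW ltkn)); apply: eq_bigr => i _.
  by rewrite /rho nth_cat szrs1 /= ltn_ord.
have Es : mmap ev rho (sub s (p s)) =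
    ratr (p s).@[extend_last (tnth a) g0`_(j (x s))].
  apply: (etrans (subE _ ev rho s (p s))); rewrite Prs1 coef_map.
  apply: esym; apply: (@mpoly_rmorph_ext _ _ algC (ratr \o meval _) (mmap _ _)).
  - by move=> c; rewrite /= mmapC /= !mevalC.
  - move=> i; rewrite /= mmapX mmap1U mevalXU /extend_last.
    by case: (unlift ord_max i) => [u|] //=; rewrite mevalXU.
have nz_ps : (ratr (p s).@[extend_last (tnth a) g0`_(j (x s))] : algC) != 0.
  by rewrite fmorph_eq0; case: (pP s).
by move: nz_ps; rewrite -Es.
Qed.

Lemma dvdp_comp_scaleX (F : fieldType) (c : F) (p q : {poly F}) :
  c != 0 -> (q \Po (c *: 'X) %| p \Po (c *: 'X)) = (q %| p).
Proof.
move=> nz_c; apply/idP/idP; last exact: dvdp_comp_poly.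
move/(dvdp_comp_poly (c^-1 *: 'X)); rewrite -!comp_polyA.
by rewrite comp_polyZ comp_polyX scalerA divff // scale1r !comp_polyXr.
Qed.

Lemma irreducible_comp_scaleX (F : fieldType) (c : F) (p : {poly F}) :
  c != 0 -> irreducible_poly (p \Po (c *: 'X)) <-> irreducible_poly p.
Proof.
move=> nz_c.
have szX d : d != 0 -> size (d *: 'X : {poly F}) = 2%N.
  by move=> nz_d; rewrite size_scale ?size_polyX.
have imp (d : F) (r : {poly F}) : d != 0 ->
    irreducible_poly (r \Po (d *: 'X)) -> irreducible_poly r.
  move=> nz_d; have szd := szX d nz_d; case=> r_gt1 irr; split=> [|q szq qr].
    by rewrite size_comp_poly2 in r_gt1.
  have := irr (q \Po (d *: 'X)); rewrite size_comp_poly2 // dvdp_comp_scaleX //.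
  by move/(_ szq qr); rewrite /eqp !dvdp_comp_scaleX.
split; first exact: imp.
move=> irr; apply: (imp c^-1); first by rewrite invr_eq0.
by rewrite -comp_polyA comp_polyZ comp_polyX scalerA divff // scale1r comp_polyXr.
Qed.

Lemma irreducible_scale (F : fieldType) (c : F) (p : {poly F}) :
  c != 0 -> irreducible_poly (c *: p) <-> irreducible_poly p.
Proof.
move=> nz_c; rewrite /irreducible_poly size_scale //.
by split=> -[? irr]; split=> // q szq; have := irr q szq;
  rewrite /eqp ?dvdpZr ?dvdpZl.
Qed.

(** The polynomial l^(n - 1) P(X / l), where n is the degree of P and l its
    leading coefficient. *)
Definition monic_multiple (T : nzRingType) (P : {poly T}) : {poly T} :=
  \poly_(i < size P) (if i.+1 == size P then 1
                      else P`_i * lead_coef P ^+ (size P - i.+2)).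

Lemma monic_multiple_monic (T : nzRingType) (P : {poly T}) :
  P != 0 -> monic_multiple P \is monic.
Proof.
rewrite -size_poly_gt0 => P_gt0.
have P1 : (size P).-1.+1 = size P by rewrite prednK.
rewrite monicE lead_coefE size_poly_eq ?coef_poly ?P1 ?eqxx ?oner_neq0 //.
by rewrite leqnn.
Qed.

Lemma monic_multiple_map (S T : nzRingType) (f : {rmorphism S -> T}) (P : {poly S}) :
  f (lead_coef P) != 0 -> map_poly f (monic_multiple P) = monic_multiple (map_poly f P).
Proof.
move=> nz_l; have szP := size_map_poly_id0 nz_l.
have lP : lead_coef (map_poly f P) = f (lead_coef P) by rewrite lead_coef_map_eq.
apply/polyP=> i; rewrite coef_map !coef_poly szP lP.
case: ltnP => [lti|_] /=; last by rewrite rmorph0.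
by case: eqP; rewrite ?rmorph1 // rmorphM rmorphXn.
Qed.

Lemma coef_comp_scaleX (T : comNzRingType) (c : T) (p : {poly T}) i :
  (p \Po (c *: 'X))`_i = p`_i * c ^+ i.
Proof.
rewrite coef_comp_poly (eq_bigr (fun j : 'I_(size p) =>
  if j == i :> nat then p`_i * c ^+ i else 0)) => [|j _]; last first.
  rewrite exprZn coefZ coefXn eq_sym.
  by case: eqP => [->|_]; rewrite ?mulr1 ?mulr0.
have [lti|lei] := ltnP i (size p); last first.
  rewrite nth_default // mul0r big1 // => j _.
  by case: eqP => // ji; rewrite leqNgt -ji ltn_ord in lei.
rewrite -big_mkcond (bigD1 (Ordinal lti)) //= big1 ?addr0 // => j.
by case/andP=> /eqP ji /eqP[]; apply: val_inj.
Qed.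

Lemma monic_multiple_comp (T : comNzRingType) (P : {poly T}) :
  (1 < size P)%N ->
  monic_multiple P \Po (lead_coef P *: 'X) = lead_coef P ^+ (size P - 2) *: P.
Proof.
move=> P_gt1; apply/polyP=> i; rewrite coef_comp_scaleX coef_poly coefZ.
case: ltnP => [lti|lei]; last by rewrite mul0r nth_default // mulr0.
case: eqP => [szP|/eqP neP].
  by rewrite mul1r lead_coefE -szP /= -exprSr -subSn ?subSS ?subn0 // szP.
rewrite -mulrA -exprD mulrC; congr (_ ^+ _ * _).
have lt2 : (i.+2 <= size P)%N by rewrite ltn_neqAle neP.
by rewrite -[i.+2]add2n subnDA subnK // leq_subRL.
Qed.

Lemma thin_C1_proper (m : nat) (q : {mpoly rat[m]}) : q != 0 ->
  thin [set a : m.-tuple rat | q.@[tnth a] = 0]%classic.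
Proof.
move=> nz_q; apply: (@thin_cover m unit (fun=> [set a | q.@[tnth a] = 0]%classic)).
  by move=> _; left; exists q.
by move=> a qa; exists tt.
Qed.

Lemma thinU (m : nat) (E E' : set (m.-tuple rat)) :
  thin E -> thin E' -> thin (E `|` E')%classic.
Proof.
case=> [k [B [thinB EB]]] [k' [B' [thinB' EB']]].
apply: (@thin_cover m ('I_k + 'I_k')%type
  (fun x => match x with inl i => B i | inr i => B' i end)).
  by case.
by move=> a [/EB[i Bi]|/EB'[i Bi]]; [exists (inl i)|exists (inr i)].
Qed.

Lemma thin_sub (m : nat) (E E' : set (m.-tuple rat)) :
  (E `<=` E')%classic -> thin E' -> thin E.
Proof.
by move=> sEE' [k [B [thinB EB]]]; exists k, B; split=> // a /sEE'; apply: EB.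
Qed.

(** The points where the leading coefficient vanishes form a set of type (C1).
    Elsewhere P and its monic multiple have specialisations that differ by
    scalings of the variable and of the values, so that the monic case
    applies. *)
Lemma thin_reducible (m : nat) (P : {poly {mpoly rat[m]}}) :
  (1 < size P)%N -> generically_irreducible P ->
  thin [set a | ~ (irreducible_poly (specialize a P)
                   /\ size (specialize a P) = size P)]%classic.
Proof.
move=> P_gt1 irrP; pose l := lead_coef P.
have nz_P : P != 0 by rewrite -size_poly_gt0 ltnW.
have nz_l : l != 0 by rewrite lead_coef_eq0.
have irrE (a : m.-tuple rat) : l.@[tnth a] != 0 ->
    size (specialize a P) = size P /\
    (irreducible_poly (specialize a (monic_multiple P))
     <-> irreducible_poly (specialize a P)).
  move=> nz_la; have szPa : size (specialize a P) = size P.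
    exact: size_map_poly_id0.
  split=> //; rewrite /specialize monic_multiple_map // -/(specialize a P).
  have lPa : lead_coef (specialize a P) = l.@[tnth a] by rewrite lead_coef_map_eq.
  have := @monic_multiple_comp _ (specialize a P).
  rewrite szPa lPa => /(_ P_gt1) E.
  apply: iff_trans (iff_sym (irreducible_comp_scaleX _ nz_la)) _.
  by rewrite E irreducible_scale // expf_neq0.
apply: thin_sub (thinU (thin_C1_proper nz_l)
  (thin_reducible_monic (monic_multiple_monic nz_P) _)); last first.
  move=> q nz_q; have [|a [qla irr]] := irrP (q * l); first by rewrite mulf_neq0.
  move: qla; rewrite mevalM mulf_eq0 negb_or => /andP[qa la].
  by exists a; split=> //; have [_ [_ H]] := irrE a la; apply: H.
move=> a /= bad; have [la|la] := eqVneq l.@[tnth a] 0; [left|right] => //= irr.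
by apply: bad; have [-> [H _]] := irrE a la; split=> //; apply: H.
Qed.

(** * Polynomials with integer coefficients as coefficient lists *)

(** Large polynomial identities are decided by evaluating functions on lists
    of coefficients, constant coefficient first.  The operations are generic in
    the type C of coefficients, so that they can be iterated to handle several
    variables.  What they mean is recorded by [peval], Horner evaluation
    through a map [ev] compatible with the operations of C. *)
Section CoefficientLists.

Variables (C : Type) (c0 : C) (cadd cmul : C -> C -> C).

Fixpoint padd (p q : seq C) : seq C :=
  match p, q with
  | [::], _ => q
  | _, [::] => p
  | a :: p', b :: q' => cadd a b :: padd p' q'
  end.

Definition pscale (a : C) (p : seq C) : seq C := [seq cmul a b | b <- p].

Fixpoint pmul (p q : seq C) : seq C :=
  if p is a :: p' then padd (pscale a q) (c0 :: pmul p' q) else [::].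

(* Long division of coefficient lists written from the leading coefficient
   down; [cdiv] divides a coefficient by the leading coefficient of [b] *)
Fixpoint subtract_multiple (k : C) (b a : seq C) : seq C :=
  match b, a with
  | x :: b', y :: a' => cadd y (cmul k x) :: subtract_multiple k b' a'
  | _, _ => a
  end.

Fixpoint divide_rev (cdiv copp : C -> C) (fuel : nat) (a b : seq C) : seq C :=
  if fuel isn't n.+1 then [::] else
  if (size a < size b)%N then [::] else
  let k := cdiv (head c0 a) in
  k :: divide_rev cdiv copp n (behead (subtract_multiple (copp k) b a)) b.

Definition pdivide (cdiv copp : C -> C) (a b : seq C) : seq C :=
  rev (divide_rev cdiv copp (size a) (rev a) (rev b)).

Variables (T : comNzRingType) (ev : C -> T).
Hypothesis ev0 : ev c0 = 0.
Hypothesis evD : forall a b, ev (cadd a b) = ev a + ev b.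
Hypothesis evM : forall a b, ev (cmul a b) = ev a * ev b.

Definition peval (x : T) (p : seq C) : T := foldr (fun c v => ev c + x * v) 0 p.

Lemma peval_add x p q : peval x (padd p q) = peval x p + peval x q.
Proof.
elim: p q => [|a p IHp] [|b q] /=; rewrite ?add0r ?addr0 //.
by rewrite evD IHp; ring.
Qed.

Lemma peval_scale x a p : peval x (pscale a p) = ev a * peval x p.
Proof. by elim: p => [|b p IHp] /=; rewrite ?mulr0 // evM IHp; ring. Qed.

Lemma peval_mul x p q : peval x (pmul p q) = peval x p * peval x q.
Proof.
elim: p => [|a p IHp] /=; first by rewrite mul0r.
by rewrite peval_add peval_scale /= ev0 IHp; ring.
Qed.

Lemma peval_zero x (czero : pred C) (p : seq C) :
  (forall c, czero c -> ev c = 0) -> all czero p -> peval x p = 0.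
Proof.
move=> ev_zero; elim: p => //= c p IHp /andP[/ev_zero -> /IHp ->].
by rewrite mulr0 addr0.
Qed.

End CoefficientLists.

Definition Zr (T : nzRingType) (z : Z) : T := (int_of_Z z)%:~R.

Lemma Zr0 (T : nzRingType) : Zr T Z0 = 0. Proof. by []. Qed.

Lemma Zr_pos (T : nzRingType) (p : positive) : Zr T (Zpos p) = (Pos.to_nat p)%:R.
Proof. by []. Qed.

Lemma Zr_neg (T : nzRingType) (p : positive) : Zr T (Zneg p) = - (Pos.to_nat p)%:R.
Proof.
by rewrite -[Zneg p]/(Z.opp (Zpos p)) /Zr (rmorphN int_of_Z (Zpos p)) rmorphN.
Qed.

Definition ZrE := (Zr0, Zr_pos, Zr_neg).

Lemma ZrD (T : nzRingType) (a b : Z) : Zr T (Z.add a b) = Zr T a + Zr T b.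
Proof. by rewrite /Zr (rmorphD int_of_Z a b) rmorphD. Qed.

Lemma ZrM (T : nzRingType) (a b : Z) : Zr T (Z.mul a b) = Zr T a * Zr T b.
Proof. by rewrite /Zr (rmorphM int_of_Z a b) rmorphM. Qed.

Notation uadd := (padd Z.add).
Notation umul := (pmul Z0 Z.add Z.mul).
Notation badd := (padd uadd).
Notation bmul := (pmul [::] uadd umul).
Notation ueval T := (@peval Z T (Zr T)).

Definition uneg (p : seq Z) : seq Z := [seq Z.opp c | c <- p].
Definition bneg (p : seq (seq Z)) : seq (seq Z) := [seq uneg c | c <- p].
Definition uzero (p : seq Z) : bool := all (Z.eqb 0) p.
Definition bzero (p : seq (seq Z)) : bool := all uzero p.

Section Evaluation.
Variable T : comNzRingType.
Implicit Types (x t : T) (p q : seq Z) (P Q : seq (seq Z)).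

Definition beval t x P : T := peval (ueval T t) x P.

Lemma ueval_add t p q : ueval T t (uadd p q) = ueval T t p + ueval T t q.
Proof. exact/peval_add/ZrD. Qed.

Lemma ueval_mul t p q : ueval T t (umul p q) = ueval T t p * ueval T t q.
Proof. by apply: peval_mul; [exact: Zr0 | exact: ZrD | exact: ZrM]. Qed.

Lemma ueval_neg t p : ueval T t (uneg p) = - ueval T t p.
Proof.
elim: p => [|c p IHp] /=; first by rewrite oppr0.
by rewrite IHp /Zr (rmorphN int_of_Z c) rmorphN /=; ring.
Qed.

Lemma ueval_zero t p : uzero p -> ueval T t p = 0.
Proof. by apply: peval_zero => c /Z.eqb_eq <-. Qed.

Lemma beval_add t x P Q : beval t x (badd P Q) = beval t x P + beval t x Q.
Proof. exact/peval_add/ueval_add. Qed.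

Lemma beval_mul t x P Q : beval t x (bmul P Q) = beval t x P * beval t x Q.
Proof. by apply: peval_mul; [|exact: ueval_add|exact: ueval_mul]. Qed.

Lemma beval_scale t x c P : beval t x (pscale umul c P) = ueval T t c * beval t x P.
Proof. exact/peval_scale/ueval_mul. Qed.

Lemma beval_neg t x P : beval t x (bneg P) = - beval t x P.
Proof.
elim: P => [|c P IHP] /=; first by rewrite /beval /= oppr0.
by rewrite /beval /= in IHP *; rewrite ueval_neg IHP; ring.
Qed.

Lemma beval_zero t x P : bzero P -> beval t x P = 0.
Proof. by apply: peval_zero => c; apply: ueval_zero. Qed.

(** Substitutes the fraction num / den for the variable of P without leaving
    polynomials: the pair consists of the numerator and the denominator
    den^(size P). *)
Fixpoint homogenize (num den : seq (seq Z)) (P : seq (seq Z)) :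
    seq (seq Z) * seq (seq Z) :=
  if P is c :: P' then
    let: (v, dn) := homogenize num den P' in
    let dn' := bmul den dn in (badd (pscale umul c dn') (bmul num v), dn')
  else ([::], [:: [:: Zpos 1]]).

Lemma homogenize_eval (t s y : T) num den P :
  beval t s den * y = beval t s num ->
  beval t s (homogenize num den P).2 = beval t s den ^+ size P /\
  beval t s (homogenize num den P).1 = beval t s den ^+ size P * beval t y P.
Proof.
move=> num_den; elim: P => [|c P [IH2 IH1]] /=.
  by rewrite /beval /= /Zr /= expr0 !(mulr0, addr0).
case E: (homogenize num den P) => [v dn] /= in IH1 IH2 *.
rewrite beval_mul IH2 exprS; split=> //.
rewrite beval_add beval_scale !beval_mul IH1 IH2 -num_den {5}/beval /= -/(beval t y P).
ring.
Qed.

End Evaluation.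

Section BasicTables.
Local Open Scope Z_scope.
Definition c_one : seq (seq Z) := [:: [:: 1]].
Definition c_t : seq (seq Z) := [:: [:: 0; 1]].
Definition c_s : seq (seq Z) := [:: [::]; [:: 1]].
End BasicTables.

Definition bsub P Q := badd P (bneg Q).
Definition bsquare P := bmul P P.

Section BasicEvaluation.
Variables (T : comNzRingType) (t s : T).

Lemma beval_const p : beval t s [:: p] = ueval T t p.
Proof. by rewrite /beval /= mulr0 addr0. Qed.
Lemma beval_one : beval t s c_one = 1.
Proof. by rewrite /beval /= !mulr0 !addr0. Qed.
Lemma beval_t : beval t s c_t = t.
Proof. by rewrite /beval /= !mulr0 !addr0 add0r mulr1. Qed.
Lemma beval_s : beval t s c_s = s.
Proof. by rewrite /beval /= !mulr0 !addr0 add0r mulr1. Qed.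

End BasicEvaluation.

(** Division has to start from a nonzero leading coefficient, so zeros at the
    end of a list are removed first. *)
Definition utrim (p : seq Z) : seq Z :=
  let q := rev p in rev (drop (find (fun c => ~~ Z.eqb 0 c) q) q).
Definition btrim (P : seq (seq Z)) : seq (seq Z) :=
  let Q := rev (map utrim P) in rev (drop (find (fun c => ~~ nilp c) Q) Q).
Definition uquotient (p q : seq Z) : seq Z :=
  let l := last Z0 q in pdivide Z0 Z.add Z.mul (fun c => Z.div c l) Z.opp p q.
Definition bquotient (P Q : seq (seq Z)) : seq (seq Z) :=
  let l := last [::] Q in pdivide [::] uadd umul (fun c => uquotient c l) uneg P Q.

(** Soundness rests on the comparison of Q with the product alone, whatever
    quotient the long division returns. *)
Definition bdivides (P Q : seq (seq Z)) : bool :=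
  bzero (bsub Q (bmul P (bquotient (btrim Q) (btrim P)))).

Lemma bdivides_root (T : comNzRingType) (t x : T) P Q :
  bdivides P Q -> beval t x P = 0 -> beval t x Q = 0.
Proof.
move=> /(beval_zero t x); rewrite beval_add beval_neg beval_mul => PQ P0.
by move: PQ; rewrite P0 mul0r subr0.
Qed.

(** * Integer polynomials without rational roots *)

Lemma rmorph_Zr (S T : nzRingType) (f : {rmorphism S -> T}) (z : Z) :
  f (Zr S z) = Zr T z.
Proof. exact: rmorph_int. Qed.

Lemma ueval_rmorph (S T : comNzRingType) (f : {rmorphism S -> T}) x p :
  f (ueval S x p) = ueval T (f x) p.
Proof.
elim: p => [|c p IHp] /=; first exact: rmorph0.
by rewrite rmorphD rmorphM rmorph_Zr IHp.
Qed.

Section NoRationalRoot.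

(** The value b^(n - 1) p(a / b), for n the size of p, as a form in a and b. *)
Fixpoint hom_eval (T : comNzRingType) (a b : T) (p : seq Z) : T :=
  if p is c :: p' then Zr T c * b ^+ size p' + a * hom_eval a b p' else 0.

Lemma hom_eval_rmorph (S T : comNzRingType) (f : {rmorphism S -> T}) a b p :
  f (hom_eval a b p) = hom_eval (f a) (f b) p.
Proof.
elim: p => [|c p IHp] /=; first exact: rmorph0.
by rewrite rmorphD !rmorphM rmorphXn rmorph_Zr IHp.
Qed.

Lemma hom_eval_div (F : fieldType) (a b : F) p : b != 0 ->
  b * hom_eval a b p = b ^+ size p * ueval F (a / b) p.
Proof.
move=> nz_b; elim: p => [|c p IHp] /=; first by rewrite !mulr0.
rewrite mulrDr [b * (a * _)]mulrCA IHp exprS; field; exact: nz_b.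
Qed.

Lemma hom_eval_last (T : comNzRingType) (a : T) c p :
  hom_eval a 0 (c :: p) = a ^+ size p * Zr T (last c p).
Proof.
elim: p c => [|d p IHp] c /=; first by rewrite mulr0 addr0 expr0 mulr1 mul1r.
by rewrite -[X in a * X]/(hom_eval a 0 (d :: p)) IHp expr0n mulr0 add0r mulrA -exprS.
Qed.

Definition Z_eval (x : Z) (p : seq Z) : Z :=
  foldr (fun c v => Z.add c (Z.mul x v)) Z0 p.

Lemma Zr_Z_eval (T : comNzRingType) x p : Zr T (Z_eval x p) = ueval T (Zr T x) p.
Proof. by elim: p => [|c p IHp] //=; rewrite ZrD ZrM IHp. Qed.

Lemma Zr_Fp_eq0 (l : nat) (z : Z) : prime l ->
  (Zr 'F_l z == 0) = Z.eqb (Z.modulo z (Z.of_nat l)) 0.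
Proof.
move=> pr_l; rewrite /Zr -(dvdz_pcharf (pchar_Fp pr_l)).
have l_gt0 : Z.of_nat l <> Z0 by case: (l) pr_l.
apply/idP/idP => [/dvdzP[k zE]|/Z.eqb_eq/(Z.mod_divide _ _ l_gt0)[k zE]].
  apply/Z.eqb_eq; rewrite -[z]int_of_ZK zE (rmorphM Z_of_int k l).
  exact: Z.mod_mul.
apply/dvdzP; exists (int_of_Z k); rewrite zE (rmorphM int_of_Z k _).
by congr (_ * _); rewrite -[RHS]Z_of_intK.
Qed.

(** The form attached to p has no zero on the projective line over F_l; the
    last coefficient takes care of the point at infinity. *)
Definition no_root_mod (l : nat) (p : seq Z) : bool :=
  [&& ~~ Z.eqb (Z.modulo (last Z0 p) (Z.of_nat l)) 0 &
  all (fun x => ~~ Z.eqb (Z.modulo (Z_eval (Z.of_nat x) p) (Z.of_nat l)) 0) (iota 0 l)].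

(** A rational root in lowest terms reduces to a point of the projective line
    over F_l at which the form attached to p vanishes. *)
Lemma no_rational_root (l : nat) (p : seq Z) (c : rat) :
  prime l -> no_root_mod l p -> ueval rat c p != 0.
Proof.
move=> pr_l /andP[lastp /allP no_root]; apply/negP => /eqP pc0.
have p_nil : p != [::] by case: (p) lastp.
have nz_d : (denq c)%:~R != 0 :> rat by rewrite intr_eq0 denq_eq0.
have homQ : hom_eval (numq c) (denq c) p = 0.
  apply/eqP; rewrite -(intr_eq0 rat) (hom_eval_rmorph (intr : {rmorphism int -> rat})).
  rewrite -(mulrI_eq0 _ (mulfI nz_d)) hom_eval_div //= divq_num_den pc0.
  by rewrite mulr0.
pose a : 'F_l := (numq c)%:~R; pose b : 'F_l := (denq c)%:~R.
have homF : hom_eval a b p = 0.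
  by rewrite -(hom_eval_rmorph (intr : {rmorphism int -> 'F_l})) homQ rmorph0.
have [b0|nz_b] := eqVneq b 0.
  have nz_a : a != 0.
    apply/negP; rewrite /a -(dvdz_pcharf (pchar_Fp pr_l)) => la.
    have ld : (l %| denq c)%Z by rewrite (dvdz_pcharf (pchar_Fp pr_l)) -/b b0.
    have := coprime_num_den c; rewrite /coprime => /eqP gcd1.
    have : (l %| gcdn `|numq c| `|denq c|)%N by move: la ld; rewrite !dvdzE dvdn_gcd /= => -> ->.
    by rewrite gcd1 dvdn1 => /eqP l1; rewrite l1 in pr_l.
  move: homF; rewrite b0; case: (p) p_nil lastp => //= e q _ lastq.
  rewrite -[X in X = 0]/(hom_eval a 0 (e :: q)) hom_eval_last => /eqP.
  by rewrite mulf_eq0 expf_eq0 (negPf nz_a) andbF /= Zr_Fp_eq0 // (negPf lastq).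
have := hom_eval_div a p nz_b; rewrite homF mulr0 => /esym/eqP.
rewrite mulf_eq0 expf_eq0 (negPf nz_b) andbF /=.
set x := a / b; have xE : x = Zr 'F_l (Z.of_nat x).
  by rewrite /Zr -[Z.of_nat x]/(Z_of_int (Posz x)) Z_of_intK -[LHS]natr_Zp.
rewrite xE -Zr_Z_eval Zr_Fp_eq0 //; apply/negP; apply: no_root.
by rewrite mem_iota /= add0n (leq_trans (ltn_ord x)) // Fp_cast.
Qed.

End NoRationalRoot.

(** * Irreducibility modulo a prime *)

(** A root of q generates a field with |F|^d elements, d the degree of q, and
    every element of that field is fixed by the d-th power of Frobenius. *)
Lemma irreducible_dvd_frobenius (F : finFieldType) (q : {poly F}) :
  irreducible_poly q -> q %| 'X^(#|F| ^ (size q).-1)%N - 'X.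
Proof.
move=> irr_q; have [Lq dimL [z qz _]] := irredp_FAdjoin irr_q.
have zN : z ^+ (#|F| ^ (size q).-1)%N = z.
  have cardL : #|(finvect_type Lq : finFieldType)| = (#|F| ^ (size q).-1)%N.
    rewrite -(@card_vspacef F (finvect_type Lq) (Vector.class (finvect_type Lq))).
    by rewrite card_vspace -dimL.
  by rewrite -cardL; apply: (expf_card (z : (finvect_type Lq : finFieldType))).
set N := 'X^_ - 'X; pose g := gcdp q N.
have gz : root (map_poly (in_alg Lq) g) z.
  rewrite gcdp_map root_gcd qz /N rmorphB /= map_polyXn map_polyX.
  by rewrite rootE !hornerE zN subrr.
have nz_g : g != 0 by rewrite gcdp_eq0 negb_and irredp_neq0.
have g1 : size g != 1%N.
  by rewrite -(size_map_poly (in_alg Lq)) gtn_eqF // (root_size_gt1 _ gz) ?map_poly_eq0.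
have /andP[_ qg] := irr_q.2 g g1 (dvdp_gcdl _ _).
exact: dvdp_trans qg (dvdp_gcdr _ _).
Qed.

(** A reducible polynomial has an irreducible factor of some degree k that is
    at most half its degree, and this factor divides X^(|F|^k) - X. *)
Lemma irreducible_coprime_frobenius (F : finFieldType) (f : {poly F}) :
  (1 < size f)%N ->
  (forall k, (0 < k <= (size f).-1./2)%N -> coprimep f ('X^(#|F| ^ k)%N - 'X)) ->
  irreducible_poly f.
Proof.
move=> f_gt1 cop; split=> // g szg gf; apply: contraT => ngf.
have nz_f : f != 0 by rewrite -size_poly_gt0 ltnW.
have small (h : {poly F}) : h %| f -> (1 < size h)%N ->
    ((size h).-1 <= (size f).-1./2)%N -> false.
  move=> hf h_gt1 hle; have nz_h : h != 0 by rewrite -size_poly_gt0 ltnW.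
  have [||q [irr_q qh _]] := irreducible_factor_where
      (Z := fun q : {poly F} => (1 < size q)%N) _ _ nz_h h_gt1.
  - by [].
  - move=> q r; apply: contraLR; rewrite negb_or -!leqNgt => /andP[q1 r1].
    by apply: leq_trans (size_polyMleq _ _) _; rewrite -subn1 leq_subLR (leq_add q1 r1).
  have q_gt1 := irr_q.1.
  have /coprimepP/(_ q (dvdp_trans qh hf) (irreducible_dvd_frobenius irr_q)) :
      coprimep f ('X^(#|F| ^ (size q).-1)%N - 'X).
    apply: cop; rewrite -ltnS prednK ?(ltnW q_gt1) // q_gt1 /=.
    by apply: leq_trans hle; rewrite -!subn1 leq_sub2r // dvdp_leq.
  by rewrite -size_poly_eq1 gtn_eqF.
have [h Dh] := dvdpP _ _ gf.
have nz_g : g != 0 by apply: contraNneq nz_f => g0; rewrite Dh g0 mulr0.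
have nz_h : h != 0 by apply: contraNneq nz_f => h0; rewrite Dh h0 mul0r.
have g_gt1 : (1 < size g)%N by rewrite ltn_neqAle eq_sym szg size_poly_gt0.
have h_gt1 : (1 < size h)%N.
  rewrite ltn_neqAle eq_sym size_poly_gt0 nz_h andbT.
  apply: contraNneq ngf => /eqP/size_poly1P[c nz_c hc].
  by rewrite Dh hc mul_polyC eqp_sym eqp_scale.
have szf : (size f).-1 = ((size h).-1 + (size g).-1)%N.
  by rewrite Dh size_mul // -{1}(prednK (ltnW h_gt1)) -{1}(prednK (ltnW g_gt1)) addSn addnS.
have [le_gh|le_hg] := leqP (size g).-1 (size h).-1.
  apply: (small g) => //; rewrite szf.
  by rewrite geq_half_double -addnn leq_add2r.
apply: (small h) => //; first by rewrite Dh dvdp_mulr.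
by rewrite szf geq_half_double -addnn leq_add2l ltnW.
Qed.

(** By Gauss's lemma a rational factor of q comes from an integral one.  Its
    reduction has the same degree, since the leading coefficient of q does not
    vanish modulo l. *)
Lemma irreducible_mod_prime (l : nat) (q : {poly int}) :
  prime l -> (lead_coef q)%:~R != 0 :> 'F_l ->
  irreducible_poly (map_poly (intr : int -> 'F_l) q) ->
  irreducible_poly (map_poly (intr : int -> rat) q).
Proof.
move=> pr_l lq irr.
have szq := size_map_poly_id0 lq.
have nz_q : q != 0 by rewrite -lead_coef_eq0; apply: contraNneq lq => ->.
have szQ : size (map_poly (intr : int -> rat) q) = size q.
  by rewrite size_map_poly_id0 // intr_eq0 lead_coef_eq0.
split=> [|f' f'1]; first by rewrite szQ -szq; case: irr.
move=> /dvdpP_rat_int[f [d nz_d fE] [g Dq]].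
rewrite fE size_scale // in f'1.
have [nz_g nz_f] : g != 0 /\ f != 0 by apply/norP; rewrite -mulf_eq0 mulrC -Dq.
have : (lead_coef f)%:~R * (lead_coef g)%:~R != 0 :> 'F_l.
  by rewrite -intrM -lead_coefM -Dq.
rewrite mulf_eq0 negb_or => /andP[lf lg].
have szf := size_map_poly_id0 lf.
rewrite size_map_poly_id0 ?intr_eq0 ?lead_coef_eq0 // in f'1.
have := irr.2 (map_poly intr f); rewrite szf => /(_ f'1).
rewrite Dq rmorphM dvdp_mulIl => /(_ isT)/eqp_size.
rewrite -rmorphM -Dq szf szq => szfq.
rewrite fE -dvdp_size_eqp; last first.
  by rewrite dvdpZl // Dq rmorphM dvdp_mulIl.
by rewrite size_scale // szQ size_map_poly_id0 ?szfq // intr_eq0 lead_coef_eq0.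
Qed.

(** * Binary forms and irreducibility certificates *)

Section FormPolynomial.
Variables (e : nat) (rows : seq (seq Z)).

(** The coefficient of y^i in d^e P(c / d, d y), where P is given by the rows;
    it is a form of degree e + i in c and d.  The truncated subtraction is exact
    when row i has degree at most e + i. *)
Definition form_coef (T : comNzRingType) (c d : T) (i : nat) : T :=
  let p := nth [::] rows i in hom_eval c d p * d ^+ (e + i.+1 - size p).

Definition form_poly (T : comNzRingType) (c d : T) : {poly T} :=
  \poly_(i < size rows) form_coef c d i.

Lemma form_coef_rmorph (S T : comNzRingType) (f : {rmorphism S -> T}) c d i :
  f (form_coef c d i) = form_coef (f c) (f d) i.
Proof. by rewrite rmorphM rmorphXn hom_eval_rmorph. Qed.

Lemma map_form_poly (S T : comNzRingType) (f : {rmorphism S -> T}) c d :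
  map_poly f (form_poly c d) = form_poly (f c) (f d).
Proof.
apply/polyP=> i; rewrite coef_map /form_poly !coef_poly /=.
by case: ifP => _; rewrite ?form_coef_rmorph ?rmorph0.
Qed.

Hypothesis degrees : forall i, (size (nth [::] rows i) <= e + i.+1)%N.

Lemma form_coefE (F : fieldType) (c d : F) i : d != 0 ->
  form_coef c d i = d ^+ (e + i) * ueval F (c / d) (nth [::] rows i).
Proof.
move=> nz_d; apply: (mulfI nz_d); rewrite /form_coef; set p := nth _ _ _.
rewrite mulrA hom_eval_div // mulrAC -exprD subnKC ?degrees //.
by rewrite addnS exprS mulrA.
Qed.

Lemma beval_sum (T : comNzRingType) (t x : T) (P : seq (seq Z)) :
  beval t x P = \sum_(i < size P) ueval T t (nth [::] P i) * x ^+ i.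
Proof.
elim: P => [|p P IHP]; first by rewrite big_ord0.
rewrite big_ord_recl expr0 mulr1 -[beval t x (p :: P)]/(ueval T t p + x * beval t x P) IHP.
congr (_ + _); rewrite mulr_sumr; apply: eq_bigr => i _.
by rewrite /= /bump /= exprS mulrCA.
Qed.

Lemma form_poly_eval (F : fieldType) (c d y : F) : d != 0 ->
  (form_poly c d).[y] = d ^+ e * beval (c / d) (d * y) rows.
Proof.
move=> nz_d; rewrite horner_poly beval_sum mulr_sumr; apply: eq_bigr => i _.
by rewrite form_coefE // exprD exprMn; ring.
Qed.

End FormPolynomial.

Section ModularCertificate.
Variable l : nat.

Definition mod_zero (p : seq Z) : bool :=
  all (fun c => Z.eqb (Z.modulo c (Z.of_nat l)) 0) p.

Definition mod_inverse (a : Z) : Z :=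
  let Zs := [seq Z.of_nat i | i <- iota 0 l] in
  nth Z0 Zs (find (fun x => Z.eqb (Z.modulo (Z.mul a x) (Z.of_nat l)) 1) Zs).

(** As for [bdivides], soundness rests on the verification of the product
    alone. *)
Definition mod_divides (f p : seq Z) : bool :=
  let a := mod_inverse (last Z0 f) in
  let quotient := pdivide Z0 Z.add Z.mul
    (fun c => Z.modulo (Z.mul c a) (Z.of_nat l)) Z.opp p f in
  mod_zero (uadd p (uneg (umul f quotient))).

Definition u_X : seq Z := [:: Z0; Zpos 1].
Definition u_one : seq Z := [:: Zpos 1].
Definition upow (p : seq Z) (n : nat) := iter n (umul p) u_one.

(** The list w contains pairs (r', v), where r' is the remainder of X^(l^k)
    modulo f for k = 1, 2, ... and v is an inverse of r' - X modulo f, which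
    proves that f is coprime to X^(l^k) - X. *)
Fixpoint frobenius_certificate (f r : seq Z) (w : seq (seq Z * seq Z)) : bool :=
  if w is (r', v) :: w' then
    [&& mod_divides f (uadd (upow r l) (uneg r')),
        mod_divides f (uadd (umul v (uadd r' (uneg u_X))) (uneg u_one))
      & frobenius_certificate f r' w']
  else true.

Arguments uneg : simpl never.
Arguments padd : simpl never.

Hypothesis pr_l : prime l.
Local Notation ev := (ueval {poly 'F_l} 'X).

Lemma ueval_Poly (T : comNzRingType) p :
  ueval {poly T} 'X p = Poly [seq Zr T c | c <- p].
Proof.
elim: p => [|c p IHp] //=; rewrite cons_poly_def -IHp mulrC addrC; congr (_ + _).
by rewrite /Zr -(rmorph_int (@polyC T)).
Qed.

Lemma mod_zero_eval p : mod_zero p -> ev p = 0.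
Proof.
apply: peval_zero => c; rewrite -(Zr_Fp_eq0 _ pr_l) => /eqP c0.
by rewrite /Zr -(rmorph_int (@polyC 'F_l)) -/(Zr _ _) c0.
Qed.

Lemma mod_divides_dvdp f p : mod_divides f p -> ev f %| ev p.
Proof.
move/mod_zero_eval; rewrite ueval_add ueval_neg ueval_mul => /eqP.
by rewrite subr_eq0 => /eqP ->; rewrite dvdp_mulIl.
Qed.

Lemma ueval_u_one (T : comNzRingType) (x : T) : ueval T x u_one = 1.
Proof. by rewrite /= mulr0 addr0. Qed.

Lemma ueval_u_X (T : comNzRingType) (x : T) : ueval T x u_X = x.
Proof. by rewrite /= mulr0 addr0 mulr1 add0r. Qed.

Lemma ueval_upow (T : comNzRingType) (x : T) p n :
  ueval T x (upow p n) = ueval T x p ^+ n.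
Proof.
elim: n => [|n IHn]; first by rewrite ueval_u_one expr0.
by rewrite /upow iterS ueval_mul -/(upow p n) IHn exprS.
Qed.

Lemma frobenius_certificate_coprime f r w N :
  frobenius_certificate f r w -> ev f %| 'X^N - ev r ->
  forall k, (k < size w)%N -> coprimep (ev f) ('X^(N * l ^ k.+1) - 'X).
Proof.
elim: w r N => [|[r' v] w IHw] r N //= /and3P[powr inv_r cert] fN.
have fN' : ev f %| 'X^(N * l) - ev r'.
  have -> : 'X^(N * l) - ev r' = ('X^N ^+ l - ev r ^+ l) + (ev r ^+ l - ev r').
    by rewrite -exprM; ring.
  apply: dvdp_add; first by rewrite subrXX dvdp_mulr.
  by have := mod_divides_dvdp powr; rewrite ueval_add ueval_neg ueval_upow.
case=> [|k] ltk; last first.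
  by have := IHw r' (N * l)%N cert fN' k ltk; rewrite -mulnA -expnS.
rewrite expn1.
have := mod_divides_dvdp inv_r.
rewrite !(ueval_add, ueval_neg, ueval_mul) ueval_u_one ueval_u_X => inv.
apply/coprimepP => g gf gN.
have gr : g %| ev r' - 'X.
  have -> : ev r' - 'X = ('X^(N * l) - 'X) - ('X^(N * l) - ev r') by ring.
  by rewrite dvdp_sub // (dvdp_trans gf).
have : g %| 1.
  have -> : 1 = ev v * (ev r' - 'X) - (ev v * (ev r' - 'X) - 1) by ring.
  by rewrite dvdp_sub ?dvdp_mull // (dvdp_trans gf).
by rewrite dvdp1 size_poly_eq1.
Qed.

Definition irreducible_certificate (f : seq Z) (w : seq (seq Z * seq Z)) : bool :=
  [&& ~~ Z.eqb (Z.modulo (last Z0 f) (Z.of_nat l)) 0, (1 < size f)%N,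
      ((size f).-1./2 <= size w)%N & frobenius_certificate f u_X w].

Lemma irreducible_certificateP f w : irreducible_certificate f w ->
  irreducible_poly (Poly [seq Zr 'F_l c | c <- f]) /\
  size (Poly [seq Zr 'F_l c | c <- f]) = size f.
Proof.
case/and4P=> last_f f_gt1 szw cert.
have szf : size (Poly [seq Zr 'F_l c | c <- f]) = size f.
  rewrite (PolyK (c := Zr 'F_l Z0)) ?size_map // last_map Zr_Fp_eq0 //.
split=> //; apply: irreducible_coprime_frobenius; rewrite szf // => k /andP[k_gt0 lek].
have := frobenius_certificate_coprime cert (N := 1) _ (k := k.-1).
rewrite prednK // mul1n card_Fp // ueval_u_X subrr dvdp0 => /(_ isT).
by rewrite ueval_Poly; apply; apply: leq_trans szw.
Qed.

End ModularCertificate.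

Lemma Zr_pow (T : comNzRingType) (a : Z) (n : nat) :
  Zr T (Z.pow a (Z.of_nat n)) = Zr T a ^+ n.
Proof.
elim: n => [|n IHn]; first by [].
by rewrite Nat2Z.inj_succ Z.pow_succ_r ?ZrM ?IHn ?exprS //; apply: Nat2Z.is_nonneg.
Qed.

Fixpoint Z_hom_eval (a b : Z) (p : seq Z) : Z :=
  if p is c :: p' then
    Z.add (Z.mul c (Z.pow b (Z.of_nat (size p')))) (Z.mul a (Z_hom_eval a b p'))
  else Z0.

Lemma Zr_hom_eval (T : comNzRingType) a b p :
  Zr T (Z_hom_eval a b p) = hom_eval (Zr T a) (Zr T b) p.
Proof.
by elim: p => [|c p IHp] //=; rewrite ZrD !ZrM Zr_pow IHp.
Qed.

Section FormIrreducible.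
Variables (e : nat) (rows : seq (seq Z)).

(** The coefficients of [form_poly] at integers c and d, in a form suited to
    evaluation. *)
Definition Z_form (c d : Z) : seq Z :=
  [seq let p := nth [::] rows i in
    Z.mul (Z_hom_eval c d p) (Z.pow d (Z.of_nat (e + i.+1 - size p)))
  | i <- iota 0 (size rows)].

Lemma form_poly_Z (T : comNzRingType) c d :
  form_poly e rows (Zr T c) (Zr T d) = Poly [seq Zr T z | z <- Z_form c d].
Proof.
apply/polyP=> i; rewrite coef_poly coef_Poly.
have [lti|lei] := ltnP i (size rows); last first.
  by rewrite nth_default // !size_map size_iota.
rewrite -map_comp (nth_map 0%N) ?size_iota // nth_iota //= add0n.
by rewrite ZrM Zr_hom_eval Zr_pow.
Qed.

(** A certificate for one point (c, d) modulo l applies to all the integer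
    points (a, b) in its residue class. *)
Lemma form_irreducible_mod (l : nat) (c d : Z) w :
  prime l -> irreducible_certificate l (Z_form c d) w ->
  forall a b : int, a%:~R = Zr 'F_l c -> b%:~R = Zr 'F_l d ->
  irreducible_poly (form_poly e rows (a%:~R : rat) b%:~R) /\
  size (form_poly e rows (a%:~R : rat) b%:~R) = size rows.
Proof.
move=> pr_l /(irreducible_certificateP pr_l); rewrite -form_poly_Z => -[irr szf] a b ac bd.
have Dmod : map_poly (intr : {rmorphism int -> 'F_l}) (form_poly e rows a b) =
    form_poly e rows (Zr 'F_l c) (Zr 'F_l d) by rewrite map_form_poly /= ac bd.
have Drat : map_poly (intr : {rmorphism int -> rat}) (form_poly e rows a b) =
    form_poly e rows (a%:~R : rat) b%:~R by rewrite map_form_poly.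
rewrite size_map size_iota in szf.
have sz_le : (size (form_poly e rows a b) <= size rows)%N by exact: size_poly.
have sz : size (form_poly e rows a b) = size rows.
  apply/eqP; rewrite eqn_leq sz_le -szf -Dmod; exact: size_poly.
have lead : (lead_coef (form_poly e rows a b))%:~R != 0 :> 'F_l.
  have : lead_coef (form_poly e rows (Zr 'F_l c) (Zr 'F_l d)) != 0.
    by rewrite lead_coef_eq0 irredp_neq0.
  by rewrite !lead_coefE szf sz -Dmod coef_map.
split.
  rewrite -Drat; apply: (irreducible_mod_prime pr_l lead).
  by rewrite [X in irreducible_poly X]Dmod.
by rewrite -Drat size_map_inj_poly ?rmorph0 //; apply: intr_inj.
Qed.

End FormIrreducible.

Section Nonvanishing.

Lemma muni_eq0 (T : comNzRingType) (n : nat) (q : {mpoly T[n.+1]}) : muni q = 0 -> q = 0.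
Proof.
pose back : {rmorphism {poly {mpoly T[n]}} -> {mpoly T[n.+1]}} :=
  horner_eval 'X_ord_max \o map_poly (@mwiden n T).
suff backK : back \o (@muni n T) =1 idfun.
  by move=> q0; have := backK q; rewrite /= q0 map_poly0 => <-; rewrite /horner_eval horner0.
apply: (@mpoly_rmorph_ext n.+1 T _ (back \o @muni n T) idfun) => [c|i].
  by rewrite /= muniC map_polyC /= /horner_eval hornerC mwidenC.
rewrite /= /muni mmapX mmap1U.
case: splitP => [j ij|j ij].
  rewrite map_polyC /= /horner_eval hornerC mwidenX mnmwiden1.
  by congr 'X__; apply: val_inj.
rewrite map_polyX /horner_eval hornerX; congr 'X__; apply: val_inj.
by rewrite /= in ij *; rewrite ij ord1 addn0.
Qed.

Lemma meval_muni (T : comNzRingType) (n : nat) (v : 'I_n.+1 -> T) (q : {mpoly T[n.+1]}) :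
  q.@[v] = ((muni q).[(v ord_max)%:MP]).@[fun i => v (widen_ord (leqnSn n) i)].
Proof.
apply: (@mpoly_rmorph_ext n.+1 T _ (meval v) (meval _ \o horner_eval _ \o @muni n T)) => [c|i].
  by rewrite /= muniC /horner_eval hornerC !mevalC.
rewrite /= mevalXU /muni mmapX mmap1U.
case: splitP => [j ij|j ij].
  rewrite /horner_eval hornerC mevalXU; congr v; exact: val_inj.
rewrite /horner_eval hornerX mevalC; congr v; apply: val_inj.
by rewrite /= in ij *; rewrite ij ord1 addn0.
Qed.

(** A nonzero polynomial does not vanish on a product of infinite sets; the
    induction looks at the last variable first, which is why [muni] is needed. *)
Lemma mpoly_nonvanishing (T : idomainType) (n : nat) (X : 'I_n -> nat -> T) (q : {mpoly T[n]}) :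
  (forall i, injective (X i)) -> q != 0 ->
  exists a : 'I_n -> nat, q.@[fun i => X i (a i)] != 0.
Proof.
elim: n X q => [|n IHn] X q injX nz_q.
  exists (fun=> 0%N); apply: contraNneq nz_q => q0.
  by rewrite (nvar0_mpolyC q) in q0 *; rewrite mevalC in q0; rewrite q0.
have nz_u : muni q != 0 by apply: contraNneq nz_q => /muni_eq0 ->.
have [k nz_k] : exists k, (muni q).[(X ord_max k)%:MP] != 0.
  apply: boolp.contrapT => all0; pose s := mkseq (fun k => (X ord_max k)%:MP_[n]) (size (muni q)).
  have := max_poly_roots (p := muni q) (rs := s) nz_u; rewrite size_mkseq ltnn.
  have -> : all (root (muni q)) s.
    apply/allP=> _ /mapP[k _ ->]; apply: contraT => nr; case: all0.
    by exists k.
  rewrite map_inj_uniq ?iota_uniq //; first by move=> H; have := H isT isT.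
  by move=> j j' /(congr1 (mcoeff 0%MM)); rewrite !mcoeffC !eqxx !mulr1 => /injX.
have [a nz_a] := IHn (fun i => X (widen_ord (leqnSn n) i)) _ (fun i => injX _) nz_k.
exists (fun i => if insub (val i) is Some j then a j else k).
rewrite meval_muni insubF ?ltnn //.
rewrite (meval_eq (v2 := fun i => X (widen_ord (leqnSn n) i) (a i))) // => i.
by rewrite /= insubT //= => lti; congr (X _ (a _)); apply: val_inj.
Qed.

End Nonvanishing.

(** * Periodic vectors of a form in normal form *)

Lemma periodic_conj (T T' : Type) (f : T -> T -> T) (g : T' -> T' -> T')
    (phi : T -> T') (w : seq letter) (v : T * T) :
  injective phi -> (forall a b, phi (f a b) = g (phi a) (phi b)) ->
  periodic f w v <-> periodic g w (phi v.1, phi v.2).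
Proof.
move=> inj_phi fg; pose Phi (u : T * T) := (phi u.1, phi u.2).
have injPhi : injective Phi.
  by case=> [a b] [c d] [] /inj_phi -> /inj_phi ->.
have PhiE u z : replace_seq g u (Phi z) = Phi (replace_seq f u z).
  elim: u z => [|l u IHu] z //=; rewrite -IHu; congr (replace_seq g u _).
  by case: l; rewrite /replace /Phi /= fg.
rewrite -/(Phi v) /periodic PhiE; split=> -[per min]; split.
- by rewrite per.
- by move=> N /min ne; rewrite PhiE => /injPhi.
- exact: injPhi.
- by move=> N /min; rewrite PhiE => ne eq; apply: ne; rewrite eq.
Qed.

(** After a proper prefix of the word the first coordinate is x1, or else it
    has returned to x and the second one is y1; so minimality is a condition on
    x1 and y1 only. *)
Lemma periodic_LRLR (T : Type) (f : T -> T -> T) (x y : T) :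
  let x1 := f x y in let y1 := f x1 y in
  periodic f [:: L; R; L; R] (x, y) <->
  [/\ f x1 y1 = x, f x y1 = y, x1 <> x & y1 <> y].
Proof.
move=> x1 y1; rewrite /periodic /replace_seq /= -/x1 -/y1; split.
  move=> [[xE yE] min]; rewrite xE in yE; split=> //.
  - by have := min 1%N isT => /= ne xx; apply: ne; rewrite -/x1 xx.
  - by have := min 3%N isT => /= ne yy; apply: ne; rewrite -/x1 -/y1 xE yy.
move=> [xE yE nx ny]; split; first by rewrite xE yE.
by case=> [|[|[|[|N]]]] //= _; rewrite -/x1 -/y1 ?xE => -[].
Qed.

Lemma periodic_LLRLR (T : Type) (f : T -> T -> T) (x y : T) :
  let x1 := f x y in let x2 := f x1 y in let y1 := f x2 y in
  periodic f [:: L; L; R; L; R] (x, y) <->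
  [/\ f x2 y1 = x, f x y1 = y, x1 <> x, x2 <> x & y1 <> y].
Proof.
move=> x1 x2 y1; rewrite /periodic /replace_seq /= -/x1 -/x2 -/y1; split.
  move=> [[xE yE] min]; rewrite xE in yE; split=> //.
  - by have := min 1%N isT => /= ne xx; apply: ne; rewrite -/x1 xx.
  - by have := min 2%N isT => /= ne xx; apply: ne; rewrite -/x1 -/x2 xx.
  - by have := min 4%N isT => /= ne yy; apply: ne; rewrite -/x1 -/x2 -/y1 xE yy.
move=> [xE yE nx nx2 ny]; split; first by rewrite xE yE.
by case=> [|[|[|[|[|N]]]]] //= _; rewrite -/x1 -/x2 -/y1 ?xE => -[].
Qed.

Definition normal_form (F : fieldType) (t x y : F) : F := t * x ^+ 2 + y ^+ 2.

(** This is s - y + q s with q = s - 2 y, the value of x on a cycle with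
    s = x + x1 = y + y1. *)
Definition x_coord (F : fieldType) (s y : F) : F :=
  (s + (s - 2 * y) * (1 + 2 * s)) / 2.

(** * Cycles of type LRLR *)

Section ShortCycle.
Variables (F : fieldType) (t : F).
Hypothesis nz_2 : 2 != 0 :> F.

(** The two equations between s and y that describe the cycles of type LRLR,
    once x has been expressed by [x_coord]. *)
Definition E1 (s : F) : F := 2 * t * s ^+ 2 + (t + 1) * s + 1.
Definition E3 (s y : F) : F :=
  2 * (t - 1) * (s - 2 * y) ^+ 2 - (t ^+ 2 + 4 * t - 1) * s - (t + 5).

Lemma mulf2_inj (a b : F) : 2 * a = 2 * b -> a = b.
Proof. exact: (mulfI nz_2). Qed.

(** Once x1, y1 and x are expressed through s and y, the difference of the
    equations for y1 and x1 is divisible by q = y1 - y, which is nonzero; the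
    quotient is E1, and E3 follows from E1 and the other equations. *)
Lemma LRLR_forward (x y : F) :
  periodic (normal_form t) [:: L; R; L; R] (x, y) ->
  exists s, [/\ E1 s = 0, E3 s y = 0 & x = x_coord s y].
Proof.
move/periodic_LRLR; rewrite /normal_form; set x1 := t * x ^+ 2 + y ^+ 2.
set y1 := t * x1 ^+ 2 + y ^+ 2 => -[hx hy nx ny].
have a1 : x1 - (t * x ^+ 2 + y ^+ 2) = 0 by rewrite subrr.
have a2 : y1 - (t * x1 ^+ 2 + y ^+ 2) = 0 by rewrite subrr.
move: x1 y1 a1 a2 hx hy nx ny => x1 y1 a1 a2 /eqP a3 /eqP a4 nx ny.
rewrite -subr_eq0 in a3; rewrite -subr_eq0 in a4.
move/eqP: a3 => a3; move/eqP: a4 => a4.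
pose s := x + x1; pose q := y1 - y.
have nz_q : q != 0 by rewrite subr_eq0; apply/eqP.
(* The alternating sum of the four equations. *)
have sy : x + x1 = y + y1.
  apply/eqP; rewrite -subr_eq0; apply/eqP.
  transitivity (x1 - (t * x ^+ 2 + y ^+ 2) + (t * x ^+ 2 + y1 ^+ 2 - y)
    - (y1 - (t * x1 ^+ 2 + y ^+ 2)) - (t * x1 ^+ 2 + y1 ^+ 2 - x)); first by ring.
  by rewrite a1 a2 a3 a4 !subr0 addr0.
have y1E : y1 = s - y by rewrite /s sy addrC addKr.
have x1E : x1 = s - x by rewrite /s addrC addKr.
have qE : q = s - 2 * y by rewrite /q y1E; ring.
have xE : x = s - y + q * s.
  apply/eqP; rewrite -subr_eq0 qE; apply/eqP.
  transitivity (- (y1 - (t * x1 ^+ 2 + y ^+ 2)) - (t * x1 ^+ 2 + y1 ^+ 2 - x)); last first.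
    by rewrite a2 a3 subr0 oppr0.
  rewrite y1E; ring.
have e1 : E1 s = 0.
  apply: (mulfI (mulf_neq0 nz_2 nz_q)); rewrite mulr0.
  transitivity (2 * ((y1 - (t * x1 ^+ 2 + y ^+ 2)) - (x1 - (t * x ^+ 2 + y ^+ 2)))); last first.
    by rewrite a1 a2 subr0 mulr0.
  rewrite y1E x1E xE qE /E1; ring.
exists s; split=> //.
  have e2 : t * (q * (1 + 2 * s)) ^+ 2 + q ^+ 2 - 2 * s + (t + 1) * s ^+ 2 = 0.
    transitivity (- (x1 - (t * x ^+ 2 + y ^+ 2)) *+ 2 + (t * x1 ^+ 2 + y1 ^+ 2 - x) *+ 2).
      rewrite y1E x1E xE qE; ring.
    by rewrite a1 a3 oppr0 !mul0rn addr0.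
  rewrite (_ : E3 s y = E1 s * (4 * (t - 1) * q ^+ 2 + 4 * (1 + 2 * t * s) * q ^+ 2
      + 2 * (t + 1) * s - (t + 5)) - 2 * (1 + 2 * t * s)
      * (t * (q * (1 + 2 * s)) ^+ 2 + q ^+ 2 - 2 * s + (t + 1) * s ^+ 2)).
    by rewrite e1 e2 mul0r mulr0 subr0.
  rewrite /E3 /E1 qE; ring.
rewrite /x_coord; apply: (mulIf nz_2); rewrite divfK // {1}xE qE; ring.
Qed.

(** The equations of the cycle are combinations of E1 and E3.  The values y1
    and y, respectively x1 and x, are different unless q = s - 2 y = 0 or
    1 + 2 s = 0.  The second case contradicts E1, and the first one makes t a
    root of 3 t^2 + 14 t + 3. *)
Lemma LRLR_backward (s y : F) :
  3 * t ^+ 2 + 14 * t + 3 != 0 -> E1 s = 0 -> E3 s y = 0 ->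
  periodic (normal_form t) [:: L; R; L; R] (x_coord s y, y).
Proof.
move=> nz_disc e1 e3; pose q := s - 2 * y; pose p := - (q * (1 + 2 * s)).
set x := x_coord s y.
have xE : 2 * x = s - p by rewrite /x /x_coord mulrC divfK // /p /q; ring.
have e2 : t * p ^+ 2 + q ^+ 2 - 2 * s + (t + 1) * s ^+ 2 = 0.
  apply: (mulfI nz_2); rewrite mulr0.
  transitivity ((1 + 2 * s) * E3 s y + E1 s * (t + 5 + 4 * q ^+ 2)).
    rewrite /E3 /E1 /p /q; ring.
  by rewrite e1 e3 !(mulr0, mul0r) addr0.
have pq : q - p * (1 + 2 * t * s) = 0.
  transitivity (2 * q * E1 s); last by rewrite e1 mulr0.
  rewrite /p /E1; ring.
pose x1 := s - x; pose y1 := s - y.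
have xE1 : x = s - y + q * s.
  by apply: mulf2_inj; rewrite xE /p /q; ring.
have hx1 : normal_form t x y = x1.
  apply: mulf2_inj; apply: mulf2_inj; apply/eqP; rewrite -subr_eq0; apply/eqP.
  transitivity ((t * p ^+ 2 + q ^+ 2 - 2 * s + (t + 1) * s ^+ 2)
     + (q - p * (1 + 2 * t * s))); last by rewrite e2 pq addr0.
  rewrite /normal_form /x1 xE1 /p /q; ring.
have hy1 : normal_form t x1 y = y1.
  apply: mulf2_inj; apply/eqP; rewrite -subr_eq0; apply/eqP.
  transitivity (2 * (normal_form t x y - x1) - (q - p * (1 + 2 * t * s))); last first.
    by rewrite pq hx1 subrr mulr0 subr0.
  rewrite /normal_form /x1 /y1 xE1 /p /q; ring.
have nz_q : q != 0.
  apply: contra_neq nz_disc => q0.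
  have e2' : s * ((t + 1) * s - 2) = 0.
    by rewrite -e2 /p q0; ring.
  have nz_s : s != 0.
    by apply: contra_eq_neq e1 => s0; rewrite /E1 s0 expr0n !mulr0 !add0r oner_eq0.
  have es : (t + 1) * s - 2 = 0.
    by apply/eqP; move/eqP: e2'; rewrite mulf_eq0 (negPf nz_s).
  (* E1 (t + 1)^2 with (t + 1) s = 2 inserted *)
  transitivity ((t + 1) ^+ 2 * E1 s - ((t + 1) * s - 2) *
     (2 * t * ((t + 1) * s + 2) + (t + 1) ^+ 2)).
    rewrite /E1; ring.
  by rewrite e1 es mulr0 mul0r subr0.
have nz_w : 1 + 2 * s != 0.
  apply: contra_neq (oner_neq0 F) => w0.
  transitivity (2 * E1 s - (1 + 2 * s) * (2 * t * s + 1)); last first.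
    by rewrite e1 w0 mulr0 mul0r subr0.
  rewrite /E1; ring.
have nz_p : p != 0 by rewrite oppr_eq0 mulf_neq0.
apply/periodic_LRLR; rewrite -/x hx1 hy1; split.
- apply/eqP; rewrite -subr_eq0; apply/eqP.
  transitivity (normal_form t x1 y - y1); last by rewrite hy1 subrr.
  rewrite /normal_form /x1 /y1 xE1 /q; ring.
- apply/eqP; rewrite -subr_eq0; apply/eqP.
  transitivity (normal_form t x y - x1); last by rewrite hx1 subrr.
  rewrite /normal_form /x1 /y1 xE1 /q; ring.
- move=> xx; case/eqP: nz_p; transitivity (s - 2 * x); first by rewrite xE; ring.
  transitivity (x1 - x); last by rewrite xx subrr.
  rewrite /x1; ring.
- move=> yy; case/eqP: nz_q; transitivity (y1 - y); last by rewrite yy subrr.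
  rewrite /y1 /q; ring.
Qed.

End ShortCycle.

(** The polynomial R with c = t and d = 1, and the fraction
    [sR_rows / sR_denominator] that equals s on the common zeros of E1 and E3. *)
Section ShortCycleRows.
Local Open Scope Z_scope.
(* Coefficients in y, then t. *)
Definition R_rows : seq (seq Z) :=
  [:: [:: 1; -2; 5; 1]; [:: 1; 6; -10; 2; 1]; [:: 1; 5; 6; -14; 1; 1];
      [:: 0; 8; -8; -8; 8]; [:: 0; 0; 16; -32; 16]].
Definition sR_rows : seq (seq Z) :=
  [:: [:: -1; -19; 28; -20; -11; -1]; [:: 0; -24; 8; 8; 8];
      [:: 0; -24; 32; -16; 0; 8]; [:: 0; 0; -64; 128; -64]].
Definition sR_denominator : seq Z := [:: 1; -6; 47; -52; 15; 10; 1].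
End ShortCycleRows.

Definition c_const (c : Z) : seq (seq Z) := [:: [:: c]].
Definition c_rho : seq (seq Z) := [:: sR_denominator].

(* rho^2 E1(h / rho) and rho^2 E3(h / rho, y), for the fraction h / rho equal to s. *)
Definition E1_numerator : seq (seq Z) :=
  badd (bmul (badd c_t c_t) (bsquare sR_rows))
    (badd (bmul (badd c_t c_one) (bmul sR_rows c_rho)) (bsquare c_rho)).
Definition E3_numerator : seq (seq Z) :=
  bsub (bmul (bmul (c_const 2) (bsub c_t c_one))
         (bsquare (bsub sR_rows (bmul (bmul (c_const 2) c_s) c_rho))))
    (badd (bmul (bsub (badd (bsquare c_t) (bmul (c_const 4) c_t)) c_one)
             (bmul sR_rows c_rho))
       (bmul (badd c_t (c_const 5)) (bsquare c_rho))).

Lemma E1_certificate : bdivides R_rows E1_numerator.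
Proof. by vm_compute. Qed.
Lemma E3_certificate : bdivides R_rows E3_numerator.
Proof. by vm_compute. Qed.

Lemma sR_denominator_neq0 (c : rat) : ueval rat c sR_denominator != 0.
Proof. exact: (@no_rational_root 3). Qed.

Section ShortCycleTables.
Variables (F : fieldType) (t : F).
Hypothesis nz_2 : 2 != 0 :> F.

(** The elimination identity: 16 R is a combination of E1 and E3. *)
Lemma R_rows_root s y : E1 t s = 0 -> E3 t s y = 0 -> beval t y R_rows = 0.
Proof.
move=> e1 e3; apply: (mulfI (expf_neq0 4 nz_2)); rewrite mulr0.
pose q := s - 2 * y.
transitivity (E1 t s * (6 + 4 * s - 8 * q - 94 * t + 20 * t * s + 8 * t * s ^+ 2 - 8 * t * q -
      32 * t * q * s + 48 * t ^+ 2 - 124 * t ^+ 2 * s - 16 * t ^+ 2 *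
      s ^+ 2 + 88 * t ^+ 2 * q + 64 * t ^+ 2 * q * s + 52 * t ^+ 3 +
      76 * t ^+ 3 * s + 8 * t ^+ 3 * s ^+ 2 - 56 * t ^+ 3 * q - 32 * t
      ^+ 3 * q * s + 18 * t ^+ 4 + 24 * t ^+ 4 * s - 16 * t ^+ 4 * q +
      2 * t ^+ 5) + E3 t s y * (-2 - 12 * t - 24 * t * s + 8 * t * q - 4 * t ^+ 2 - 4 * t ^+ 2 * s -
      48 * t ^+ 2 * s ^+ 2 + 32 * t ^+ 2 * q * s - 8 * t ^+ 2 * q ^+ 2
      + 8 * t ^+ 3 + 40 * t ^+ 3 * s + 48 * t ^+ 3 * s ^+ 2 - 8 * t ^+
      3 * q - 32 * t ^+ 3 * q * s + 8 * t ^+ 3 * q ^+ 2 + 2 * t ^+ 4 +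
      4 * t ^+ 4 * s)); last by rewrite e1 e3 !mul0r addr0.
rewrite /E1 /E3 /beval /= !ZrE /Pos.to_nat /= /q; ring.
Qed.

Lemma sR_rows_root s y : E1 t s = 0 -> E3 t s y = 0 ->
  ueval F t sR_denominator * s = beval t y sR_rows.
Proof.
move=> e1 e3; apply: (mulfI (expf_neq0 4 nz_2)).
pose q := s - 2 * y; apply/eqP; rewrite -subr_eq0; apply/eqP.
transitivity (E1 t s * (16 + 64 * t + 64 * t * s - 192 * t * q - 416 * t ^+ 2 - 128 * t ^+ 2 *
      s + 384 * t ^+ 2 * q + 256 * t ^+ 3 + 64 * t ^+ 3 * s - 192 * t
      ^+ 3 * q + 80 * t ^+ 4) + E3 t s y * (-48 * t + 16 * t ^+ 2 - 192 *
      t ^+ 2 * s + 64 * t ^+ 2 * q - 16 * t ^+ 3 + 192 * t ^+ 3 * s - 64 * t ^+ 3 * q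
      - 16 * t ^+ 4)); last by rewrite e1 e3 !mul0r addr0.
rewrite /E1 /E3 /beval /= !ZrE /Pos.to_nat /= /q; ring.
Qed.

(** Here the fraction for s is substituted into E1 and E3, and the numerators
    are divisible by R as polynomials in y over Z[t]. *)
Lemma R_rows_root_exists y : beval t y R_rows = 0 ->
  ueval F t sR_denominator != 0 ->
  let s := beval t y sR_rows / ueval F t sR_denominator in
  E1 t s = 0 /\ E3 t s y = 0.
Proof.
move=> R0; set r := ueval F t sR_denominator => nz_r.
set h := beval t y sR_rows => s; have sE : h = s * r by rewrite /s divfK.
have yE : beval t y c_s = y by exact: beval_s.
have cE c : beval t y (c_const c) = Zr F c.
  by rewrite beval_const /= mulr0 addr0.
have rE : beval t y c_rho = r by exact: beval_const.
split; apply: (mulfI (expf_neq0 2 nz_r)); rewrite mulr0.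
  rewrite -(bdivides_root E1_certificate R0) /E1_numerator /bsquare.
  rewrite !(beval_mul, beval_t, beval_one, rE, beval_add) -/h sE /E1; ring.
rewrite -(bdivides_root E3_certificate R0) /E3_numerator /bsquare /bsub.
rewrite !(beval_mul, beval_t, beval_one, cE, yE, rE, beval_neg, beval_add) -/h sE.
rewrite !ZrE /Pos.to_nat /= /E3; ring.
Qed.
End ShortCycleTables.

Lemma LRLR_cycle (F : fieldType) (t x y : F) :
  2 != 0 :> F -> t != 0 -> ueval F t sR_denominator != 0 ->
  periodic (normal_form t) [:: L; R; L; R] (x, y) ->
  beval t y R_rows = 0 /\
  x = x_coord (beval t y sR_rows / ueval F t sR_denominator) y.
Proof.
move=> nz_2 _ nz_den /(LRLR_forward nz_2)[s [e1 e3 ->]].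
split; first exact: R_rows_root e1 e3.
by rewrite -(sR_rows_root nz_2 e1 e3) [_ * s]mulrC mulfK.
Qed.

Lemma R_degrees i : (size (nth [::] R_rows i) <= 3 + i.+1)%N.
Proof. by case: i => [|[|[|[|[|i]]]]] //; rewrite nth_default. Qed.

Lemma R_row0_neq0 (c : rat) : ueval rat c (nth [::] R_rows 0) != 0.
Proof. exact: (@no_rational_root 3). Qed.

(** * Cycles of type LLRLR: elimination of the sum *)

(** The polynomial S with c = t and d = 1: coefficients in y, then in t. *)
Definition S_rows : seq (seq Z) := [::
   [:: 1; -6; 91; -7; 37; 21; 7; 1]%BinZ;
   [:: 1; 10; 56; 190; -76; -59; -25; 0; 1]%BinZ;
   [:: 1; 9; 96; 38; 12; 55; 104; 7; 1; 1]%BinZ;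
   [:: 0; 16; -16; 40; -112; 210; -192; 30; 8; 2; 1]%BinZ;
   [:: 0; 0; 32; -136; -128; 234; 208; -146; -30; -14; 1; 1]%BinZ;
   [:: 0; 0; 0; -96; 48; -496; -32; 160; 56; 112; 9; 2; 1]%BinZ;
   [:: 0; 0; 0; 64; -288; -64; 240; 144; 264; -152; 41; 11; 3; 1]%BinZ;
   [:: 0; 0; 0; 0; 0; -512; 128; 576; 864; -112; 0; 16]%BinZ;
   [:: 0; 0; 0; 0; 0; -512; 768; 2176; 448; -288; 160; 32; 32]%BinZ;
   [:: 0; 0; 0; 0; 0; 0; 0; 1536; 1024; -512]%BinZ;
   [:: 0; 0; 0; 0; 0; 0; 0; 1024; 1280; -256; -256; 256]%BinZ].

(** On the common zeros of F1 and F2 with t (1 + t s) != 0, the value of s is the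
    fraction [s_rows / s_denominator], a polynomial in y of degree 9 with
    coefficients in Q(t).  It expresses s in Q(t)[y] / (S). *)
Definition s_rows : seq (seq Z) := [::
   [:: 9437184; -54525952; -9185067008; -22882287616; -350887395328;
   -48925409280; -3447334588416; -4652899291136; 14821165155328;
   -442519846609920; 1404410918763520; -3745202916485120; 12052141320553984;
   6819500662415104; -35416588258490112; 8125981754586048; 4888502409206208;
   -42334851023173696; 11781115677208576; 19504779301480736;
   -21866339075641008; 4615358070249352; 20946465736243824; -408213628576388;
   -3980885030138400; 1981073615999058; 922674152487680; -272443443463380;
   -7433491723420; 12512212159408; -12182108905430; 1886655536908;
   -2741876292674; -2688585736940; -472887052694; -117294088152;
   -90715963624; -37907954088; -9445128190; -364995544; 493936954; 186816570;
   75479554; 35039648; 12394594; 2281152; -213908; -270048; -88512; -17328;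
   -2164; -164; -6]%BinZ;
   [:: 0; 340262912; -16380985344; 20676870144; -661243461632; 1167346614272;
   -9303752278016; 20315981352960; -22431726309376; -132866146117632;
   1352869058588672; -4840684057640960; 18828641603042304;
   -24806579860732160; -1739461762630400; 50196145202365312;
   -60492902249218752; 1759829068254656; 62152168338335424;
   -57342952985313024; -225020337502944; 49874727047879880;
   -33828167962998688; -21820799569328704; 17584891107626956;
   1709293257380118; -4162129658317296; 1306741709352901; 605709932212104;
   -52891954299880; 147757755573873; 35692502029551; 12476162260962;
   17094360729585; 4311068243354; 1388548476779; 753558095626; 229752690707;
   77745028671; 16748296140; 827064241; -493021095; -454195680; -235318686;
   -92428143; -25987599; -4040297; 102316; 338461; 155888; 50102; 12454;
   2305; 300; 25; 1]%BinZ;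
   [:: 0; 340262912; -16702373888; 37465751552; -560349347840; 1801670377472;
   -5234386780160; 14724607545344; 39775727009792; -405836136036352;
   2337619308404736; -7291372524838912; 22368349724898304;
   -28950838933972224; 1677817739883008; 34190085522460288;
   -38035822476897344; 5035842910259968; 7428735334146432;
   -26108044530680896; 8957713802591904; 16115554638498376; 8042708514984184;
   5428493331970560; 248097769350364; 998079354697826; 433940915638210;
   -411037288196975; 159483906310303; -50402334490620; -123013132084131;
   889149236038; -13657229721680; -11931621106679; -1302530714743;
   -1687640935993; -795122824670; -95996993893; -56365352703; -26445561305;
   -3683385277; 577619615; 535280782; 193532227; 68445144; 25597823; 6384371;
   496214; -365359; -205562; -59085; -10751; -1145; -22; 11; 1]%BinZ;
   [:: 0; 0; 235929600; -39898578944; 62385291264; -1384222359552;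
   389188780032; -11049816031232; -107934268530688; 360829446234112;
   -1928108013514752; 5229305155223552; -6441363121057792;
   -20664294341984256; 58136745525705216; -16485237127053312;
   -42981662632014080; 55589874880686976; -35045063044152960;
   -64257117016299392; 20442991492503840; -28395242621298688;
   -48093750557493136; 10797973993948112; 16335547920344608;
   1181332847035928; -394290933575272; -598814599059204; 791865546122848;
   781970480340232; -177681632911822; -74249685770864; 52001515370076;
   -4652447900140; -5088035506312; -871899499976; -1593494173308;
   -328728565020; -57730850888; -69806924064; -23503203852; -3788380596;
   196890294; 252247302; 82343888; 52574032; 24165236; 6720838; 845864;
   -213552; -148950; -46074; -9516; -1348; -126; -6]%BinZ;
   [:: 0; 0; 0; 1394606080; 109982515200; 57658048512; 4918512320512;
   -10522013007872; 63552887259136; -198139496382464; 436524631883776;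
   481645492944896; -4147139737165824; 16776401892311040; -29353956024403968;
   -27940169879288832; 77722950885026816; -49873893907360768;
   17304988038866688; 89535468464409600; -49252330004440064;
   17940673168048064; 35156253058286400; -22260178107306048;
   1915293563822848; -18636852987400960; -16268234940234600;
   11817514501994720; 1198083039010464; -4352735439274388; 1128666697976810;
   612435568108908; -176889213962645; 110289944467578; 32190360449407;
   3623128333932; 13475569888993; 2920240958198; 711436158442; 523604575540;
   151180647539; 51692167119; 8749349039; -697959252; -326332278; -238667792;
   -143528878; -61094952; -16081807; -1603512; 302089; 192440; 73005; 25798;
   7754; 1688; 249; 23; 1]%BinZ;
   [:: 0; 0; 0; 1207959552; -74973184000; 325879595008; -2518203498496;
   13583350235136; -34270010540032; 77277489135616; 215956637253632;
   -1951176738734080; 10099349724954624; -30401259005517824;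
   21559436291981312; 33505943018598400; -91373137318840320;
   65787515501565952; 127648258216460288; -108172048020030464;
   45167452991664128; 113755900942753792; -103055102396207488;
   -6596118753933440; 91389702221252864; -11696849782348576;
   -17321802780789472; 20539331891191664; 3719578860971328;
   -4741932302234656; 1184986815043368; 1075933628381600; -227240603770892;
   -31644779217704; 45296363615176; 913379850352; 4338525433558;
   2005122080976; -599795487046; 139608505784; 256557723320; 36936590684;
   -8370256054; 2356009550; 2780207642; 532531622; -96873062; -58791946;
   -6703174; -961282; -1576654; -728150; -121704; 22722; 18204; 5082; 850;
   86; 4]%BinZ;
   [:: 0; 0; 0; 0; 33554432; -37228642304; 507579990016; -2179012231168;
   8576171507712; -10865841799168; -124196487954432; 1527915762614272;
   -3395030643310592; 16519984632266752; -14821579997069312;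
   -44779366532284416; 432912949755904; 101383842930581504;
   -29693285454462976; -73504223763847168; 176298951902265344;
   -28759101932007424; -129543828912364544; 134049222592239104;
   12291152880024064; -100411358402273280; 43197161805518848;
   50409891290341120; -8660808371334656; -2103800662760640; 5596867158735424;
   1775543886619296; 529467763681088; 187303558108064; 91003979791168;
   94186346406336; 29121032026208; 5716465959168; 2192504339456;
   718614914656; 556946027872; 106207199808; -36069540480; -6276039840;
   1644112320; -133071072; -532327872; -184507200; -6345984; 6773632; 485696;
   -308384; 14304; 70432; 27008; 5312; 608; 32]%BinZ;
   [:: 0; 0; 0; 0; 0; -9596567552; 588108529664; -1143279190016;
   21329587732480; -66256148365312; 187358050254848; -259698878054400;
   -1030172260040704; 7392839892729856; -42706270714527744;
   29559180954140672; 93216006385991680; -32413970908774400;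
   26156318845001728; 1194076837822464; -149694677195280384;
   -80203032915836928; -62442362531282944; -75693557451083776;
   4997702524644352; 15498095871331328; 12932256384620032; 27711323653624832;
   5311247825200640; -3857038132771072; 5623945113952256; 3602477135496064;
   -83299286703360; 299410726865408; 316876693236864; 79398816976320;
   51279337281152; 17017992011840; 2951254233856; 3095163865088;
   1338943493888; 224186281152; 20249350464; 10737308864; 8910543424;
   731871936; -1228848320; -450656320; -63597760; -10188864; -7269056;
   -2490240; 34368; 295680; 110784; 21952; 2496; 128]%BinZ;
   [:: 0; 0; 0; 0; 0; 0; -134217728; 86570434560; -1439778734080;
   4042327588864; -20828156592128; 105181694918656; 416778315366400;
   -1280762636402688; 6036043861327872; -19446451557367808;
   20027529325510656; 76392307649019904; -39266947732078592;
   -96344429690306560; -65271691989729280; -112453655694295040;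
   -151477285607440384; -62173230643970048; 60762464876500992;
   24280316366352384; -9571966455136256; 47475452273685504;
   27026908127037952; -12803993290745856; 1932158769196800; 7245397195168256;
   -407812748729600; -456575058690048; 401452511488768; 28697130037248;
   2387127666176; 11206937238528; -5075334886656; -217216039168;
   691683351808; -81675904000; -93160123392; -11884811264; 6981748736;
   1202707456; -599780608; -80844800; 53989120; 18506752; -843520; -1681408;
   -278528; 32768; 21248; 3840; 256]%BinZ;
   [:: 0; 0; 0; 0; 0; 0; 0; 19058917376; -1132529188864; -621209976832;
   -46861968736256; 19600481714176; -323294806933504; -426133029912576;
   847682653913088; -15293315293904896; 43866247337607168; 79880339814350848;
   -75245166477443072; -15462980561141760; 58344136845197312;
   -209864444411543552; -159354431418105856; 14200239744770048;
   -116759658411794432; -55875476946489344; 78880886121840640;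
   6378251552137216; -23706590398445568; 10230562549309440; 6236696453653504;
   -31465349007360; 1414791265318912; 321441400436736; 113940851492352;
   235748280064000; 44992641182208; 9595803777024; 11008483526656;
   2997741876224; 1626403234304; 466672961024; -45606129152; 18400837120;
   18166395392; -909804032; -2380684800; -596871680; -35091968; -12137984;
   -13783040; -3063296; 676864; 520704; 133632; 17920; 1024]%BinZ].

Definition s_denominator : seq Z :=
  [:: -9437184; 404226048; -7807762432; 92326658048; -339959201792;
  3118354268160; -4181110288384; 39603131486208; 86668130290688;
  -134406011334656; 2173273729490944; -7693935412348928; 16556164850641408;
  -27202271610979840; 3037184498517504; 50648439810653888;
  -38026088171681344; 17889263942934528; 54635693596253504;
  -34691078612977440; 5261425440536912; 36944655496428208;
  -15444353113738272; -11598790215147348; 9178511416621976; 1228493269639208;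
  -1998404228362060; 601010102103283; 332989072126439; -16402100963463;
  67251594325080; 24600461215896; 8304125804700; 8561177667087;
  2928691873115; 938586430492; 447413324399; 174054596183; 55442828010;
  11526739086; 2009164786; 280988899; -189579673; -159267034; -65682657;
  -18186834; -3726919; -529211; 65738; 93102; 41238; 11635; 2251; 298; 25;
  1]%BinZ.

(** The equation F1 is linear in y.  With w = 1 + 2 s, g = t s w (1 + t s),
    n = - (g + 1 + s) and d = t g w it says that s - 2 y = - n / d, that is,
    y = (s d + n) / (2 d). *)
Definition c_w := badd c_one (badd c_s c_s).
Definition c_g := bmul c_t (bmul c_s (bmul c_w (badd c_one (bmul c_t c_s)))).
Definition c_n := bneg (badd c_g (badd c_one c_s)).
Definition c_d := bmul c_t (bmul c_g c_w).
Definition c_sd := bmul c_s c_d.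
Definition c_pd := bmul c_n c_w.
Definition y_denominator := badd c_d c_d.
Definition y_numerator := badd c_sd c_n.
(** The numerator of F2 after the substitution of this value of y. *)
Definition s_polynomial :=
  bsub (bmul (badd c_sd c_pd) y_denominator)
    (badd (bmul c_t (bsquare (bsub c_sd c_pd))) (bsquare y_numerator)).

(** S becomes a polynomial in s once y is replaced by its fraction; it is
    divisible by the relation satisfied by s. *)
Lemma S_rows_certificate :
  bdivides s_polynomial (homogenize y_numerator y_denominator S_rows).1.
Proof. by vm_compute. Qed.

Definition s_relation (vd : seq (seq Z) * seq (seq Z)) : seq (seq Z) :=
  bsub vd.1 (bmul [:: s_denominator] (bmul c_s vd.2)).

Lemma s_rows_certificate :
  bdivides s_polynomial (s_relation (homogenize y_numerator y_denominator s_rows)).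
Proof. by vm_compute. Qed.

Lemma s_denominator_neq0 (c : rat) : ueval rat c s_denominator != 0.
Proof. exact: (@no_rational_root 5). Qed.

Section Elimination.
Variables (F : fieldType) (t s y : F).

(** The two equations between s and y that describe the cycles of type LLRLR;
    F2 says that x1 = s - x is the first replacement of x. *)
Definition F1 : F :=
  1 + s + t * s * (1 + 2 * s) * (1 + t * s) * (1 - t * ((s - 2 * y) * (1 + 2 * s))).
Definition F2 : F :=
  2 * (s - (s - 2 * y) * (1 + 2 * s))
  - t * (s + (s - 2 * y) * (1 + 2 * s)) ^+ 2 - 4 * y ^+ 2.

Let bevalE := (beval_add, beval_neg, beval_mul, beval_one, beval_t, beval_s).

Lemma beval_d : beval t s c_d =
  t ^+ 2 * s * (1 + 2 * s) ^+ 2 * (1 + t * s).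
Proof. rewrite /c_d /c_g /c_w !bevalE; ring. Qed.

Lemma beval_n : beval t s c_n =
  - (t * s * (1 + 2 * s) * (1 + t * s) + 1 + s).
Proof. rewrite /c_n /c_g /c_w !bevalE; ring. Qed.

Lemma beval_y_denominator : beval t s y_denominator =
  2 * t ^+ 2 * s * (1 + 2 * s) ^+ 2 * (1 + t * s).
Proof. rewrite /y_denominator beval_add beval_d; ring. Qed.

Lemma y_fraction : F1 = 0 ->
  beval t s y_denominator * y = beval t s y_numerator.
Proof.
move=> F10; apply/eqP; rewrite -subr_eq0; apply/eqP; rewrite -[RHS]F10.
rewrite beval_y_denominator /y_numerator /c_sd beval_add beval_mul beval_s beval_d beval_n.
rewrite /F1; ring.
Qed.

Lemma s_polynomial_root : F1 = 0 -> F2 = 0 -> beval t s s_polynomial = 0.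
Proof.
move=> F10 F20.
(* F1 says that n = - (s - 2 y) d, and then the polynomial is d^2 F2. *)
pose d := t ^+ 2 * s * (1 + 2 * s) ^+ 2 * (1 + t * s).
pose n := - (t * s * (1 + 2 * s) * (1 + t * s) + 1 + s).
have nE : n = - (s - 2 * y) * d by rewrite -[RHS]addr0 -oppr0 -F10 /n /d /F1; ring.
have -> : beval t s s_polynomial =
    2 * (s * d + n * (1 + 2 * s)) * d
    - (t * (s * d - n * (1 + 2 * s)) ^+ 2 + (s * d + n) ^+ 2).
  rewrite /s_polynomial /y_denominator /y_numerator /c_sd /c_pd /c_d /c_n /c_g /c_w.
  rewrite /bsub /bsquare !bevalE /d /n; ring.
rewrite nE -[RHS](mulr0 (d ^+ 2)) -F20 /F2; ring.
Qed.

Hypotheses (nz_2 : 2 != 0 :> F) (nz_t : t != 0) (nz_ts : 1 + t * s != 0).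

Lemma y_denominator_neq0 : F1 = 0 -> beval t s y_denominator != 0.
Proof.
move=> F10.
have nz_s : s != 0.
  apply: contra_eq_neq F10 => s0; rewrite /F1 s0 !(mul0r, mulr0, addr0).
  exact: oner_neq0.
have nz_w : 1 + 2 * s != 0.
  apply: contra_eq_neq F10 => w0; rewrite /F1 w0 !(mul0r, mulr0, addr0).
  have -> : 1 + s = 1 + 2 * s - s by ring.
  by rewrite w0 sub0r oppr_eq0.
by rewrite beval_y_denominator !(mulf_neq0, expf_neq0).
Qed.

Lemma S_rows_root : F1 = 0 -> F2 = 0 -> beval t y S_rows = 0.
Proof.
move=> F10 F20.
have [_] := homogenize_eval S_rows (y_fraction F10).
rewrite (bdivides_root S_rows_certificate (s_polynomial_root F10 F20)).
move/esym/eqP; rewrite mulf_eq0 expf_eq0 (negPf (y_denominator_neq0 F10)) andbF.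
by move/eqP.
Qed.

Lemma s_rows_root : F1 = 0 -> F2 = 0 ->
  ueval F t s_denominator * s = beval t y s_rows.
Proof.
move=> F10 F20.
have := bdivides_root s_rows_certificate (s_polynomial_root F10 F20).
have := homogenize_eval s_rows (y_fraction F10).
move: (homogenize y_numerator y_denominator s_rows) => vd [E2 E1].
rewrite /s_relation /bsub beval_add beval_neg !beval_mul beval_s beval_const E1 E2.
move/eqP; rewrite subr_eq0 => /eqP E.
apply: (mulfI (expf_neq0 (size s_rows) (y_denominator_neq0 F10))).
move: E; move: (beval t y s_rows) (ueval F t s_denominator).
move: (beval t s y_denominator ^+ _) => D B r E.
by rewrite E mulrCA [D * s]mulrC.
Qed.

End Elimination.

(** * Cycles of type LLRLR: existence of a common root *)

(** The expansion along the first row, on functions of indices, so that the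
    determinant can be evaluated on lists by [blaplace]. *)
Fixpoint laplace (T : pzRingType) (n : nat) (f : nat -> nat -> T) : T :=
  if n is n'.+1 then
    \sum_(j < n'.+1) (-1) ^+ j * f 0%N j * laplace n' (fun i k => f i.+1 (bump j k))
  else 1.

Lemma det_laplace (T : comNzRingType) n (f : nat -> nat -> T) :
  \det (\matrix_(i < n, j < n) f i j) = laplace n f.
Proof.
elim: n f => [|n IHn] f; first by rewrite det_mx00.
rewrite (expand_det_row _ ord0) /=; apply: eq_bigr => j _.
rewrite mxE /cofactor add0n mulrCA mulrA -IHn; congr (_ * \det _).
by apply/matrixP => i k; rewrite !mxE.
Qed.

Fixpoint blaplace (n : nat) (f : nat -> nat -> seq (seq Z)) : seq (seq Z) :=
  if n is n'.+1 then
    foldr (fun j v => badd v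
      (bmul (if odd j then bneg (f 0%N j) else f 0%N j)
        (blaplace n' (fun i k => f i.+1 (bump j k))))) [::] (iota 0 n'.+1)
  else c_one.

Lemma beval_blaplace (T : fieldType) (t y : T) n f :
  beval t y (blaplace n f) = laplace n (fun i j => beval t y (f i j)).
Proof.
elim: n f => [|n IHn] f; first exact: beval_one.
transitivity (\sum_(j <- iota 0 n.+1) (-1) ^+ j * beval t y (f 0%N j) *
  laplace n (fun i k => beval t y (f i.+1 (bump j k)))); last first.
  by rewrite -[iota 0 n.+1]/(index_iota 0 n.+1) big_mkord.
rewrite -[blaplace n.+1 f]/(foldr (fun j v => badd v
  (bmul (if odd j then bneg (f 0%N j) else f 0%N j)
    (blaplace n (fun i k => f i.+1 (bump j k))))) [::] (iota 0 n.+1)).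
elim: (iota 0 n.+1) => [|j r IHr]; first by rewrite big_nil.
rewrite [foldr _ _ (j :: r)]/= beval_add beval_mul IHr IHn addrC big_cons.
congr (_ * _ + _).
by rewrite -signr_odd; case: (odd j); rewrite ?beval_neg ?expr1 ?expr0 ?mulN1r ?mul1r.
Qed.

(** Multiplication by t X modulo q - t X^4, where q has degree at most 3, on
    lists of four coefficients: the product t X r is reduced by adding the last
    coefficient of r times q - t X^4. *)
Section CompanionRows.
Variables (C : Type) (add mul : C -> C -> C) (zero : C).

Definition shift_row (t : C) (q r : seq C) : seq C :=
  [seq add (mul t c.1) (mul (last zero r) c.2) | c <- zip (zero :: r) q].

Definition companion_rows (t : C) (q r : seq C) : nat -> seq C :=
  fun i => iter i (shift_row t q) r.
End CompanionRows.

Section LongCycleRows.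
Local Open Scope Z_scope.
(* Coefficients in s, then y, then t. *)
Definition G_rows : seq (seq (seq Z)) :=
  [:: [:: [:: 1]; [:: 0; -4; 4]; [:: 0; 4; -8; -4]; [:: 0; 0; 8; 8]];
      [:: [:: 1; 1]; [:: 0; -8; -2; 8]; [:: 0; 0; 4; -28]; [:: 0; 0; 0; 32]];
      [:: [:: 0; 6; 0; -4]; [:: 0; 0; -16; 26]; [:: 0; 0; 16; -48]; [:: 0; 0; 0; 32]];
      [:: [:: 0; 0; 10; -5]; [:: 0; 0; -8; 16]; [:: 0; 0; 0; -16]]].
Definition Q_rows : seq (seq (seq Z)) :=
  [:: [:: [::]; [:: 1]; [:: -1; -1]];
      [:: [::]; [:: 2; 2]; [:: 0; -4]];
      [:: [:: -1; -1]; [:: 0; 6]; [:: 0; -4]];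
      [:: [:: 0; -2]; [:: 0; 4]]].
Definition t_power_5 : seq (seq Z) := [:: [:: 0; 0; 0; 0; 0; 1]].
End LongCycleRows.

Definition companion_entry (i j : nat) : seq (seq Z) :=
  nth [::] (companion_rows badd bmul [::] c_t Q_rows G_rows i) j.

(** The resultant, up to powers of t, of the polynomials in s with
    coefficients [Q_rows] (completed by - t s^4) and [G_rows]. *)
Lemma companion_determinant :
  bzero (bsub (blaplace 4 companion_entry) (bmul t_power_5 S_rows)).
Proof. by vm_compute. Qed.

Section CommonRoot.
Variables (F : closedFieldType) (t y : F).
Local Notation ev := (beval t y).

Definition Q_poly : {poly F} := Poly [seq ev c | c <- Q_rows] - t *: 'X^4.
Definition row_poly (i : nat) : {poly F} :=
  Poly [seq ev c | c <- companion_rows badd bmul [::] c_t Q_rows G_rows i].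

Lemma size_companion_rows i :
  size (companion_rows badd bmul [::] c_t Q_rows G_rows i) = 4%N.
Proof.
rewrite /companion_rows; elim: i => [//|i IHi].
by rewrite iterS /shift_row size_map size_zip [size (_ :: _)]/= IHi.
Qed.

Lemma Poly_shift_row (q0 q1 q2 q3 r0 r1 r2 r3 : seq (seq Z)) :
  Poly [seq ev c | c <- shift_row badd bmul [::] c_t [:: q0; q1; q2; q3] [:: r0; r1; r2; r3]]
  = t *: ('X * Poly [seq ev c | c <- [:: r0; r1; r2; r3]])
    + ev r3 *: (Poly [seq ev c | c <- [:: q0; q1; q2; q3]] - t *: 'X^4).
Proof.
rewrite -[shift_row _ _ _ _ _ _]/[:: badd (bmul c_t [::]) (bmul r3 q0);
  badd (bmul c_t r0) (bmul r3 q1); badd (bmul c_t r1) (bmul r3 q2);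
  badd (bmul c_t r2) (bmul r3 q3)].
have evE a b q : ev (badd (bmul c_t a) (bmul b q)) = t * ev a + ev b * ev q.
  by rewrite beval_add; congr (_ + _); rewrite beval_mul // beval_t.
rewrite !map_cons !evE.
have -> : ev [::] = 0 by [].
rewrite /= !cons_poly_def.
rewrite !(polyCD, polyCM) -!mul_polyC; ring.
Qed.

Lemma row_polyS i : exists c : F,
  row_poly i.+1 = t *: ('X * row_poly i) + c *: Q_poly.
Proof.
have := size_companion_rows i; rewrite /row_poly /Q_poly.
have -> : companion_rows badd bmul [::] c_t Q_rows G_rows i.+1 =
  shift_row badd bmul [::] c_t Q_rows (companion_rows badd bmul [::] c_t Q_rows G_rows i) by [].
move: (companion_rows _ _ _ _ _ _ i) => [|r0 [|r1 [|r2 [|r3 [|? ?]]]]] // _.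
by exists (ev r3); rewrite -Poly_shift_row.
Qed.

Lemma row_polyE i : exists b : {poly F},
  row_poly i = (t ^+ i *: 'X^i) * row_poly 0 + b * Q_poly.
Proof.
elim: i => [|i [b IHi]]; first by exists 0; rewrite expr0 scale1r mul1r mul0r addr0.
have [c ->] := row_polyS i; exists (t *: ('X * b) + c%:P); rewrite IHi.
rewrite !exprS -!mul_polyC !polyCM; ring.
Qed.

Lemma size_Q_poly : t != 0 -> size Q_poly = 5%N.
Proof.
move=> nz_t; rewrite /Q_poly addrC size_polyDl size_polyN size_scale // size_polyXn //.
by apply: leq_ltn_trans (size_Poly _) _; rewrite size_map.
Qed.

Lemma companion_entry_coef i j : (j < 4)%N ->
  ev (companion_entry i j) = (row_poly i)`_j.
Proof.
move=> ltj; rewrite /row_poly coef_Poly /companion_entry.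
by rewrite (nth_map [::]) // size_companion_rows.
Qed.

(** A vanishing determinant gives a polynomial A of degree at most 3 such that
    Q divides A G.  Since Q has degree 4, it cannot be coprime to G. *)
Lemma common_root_exists : t != 0 -> ev S_rows = 0 ->
  exists s, root Q_poly s && root (row_poly 0) s.
Proof.
move=> nz_t S0.
have /eqP/det0P[v nz_v vN] :
    \det (\matrix_(i < 4, j < 4) ev (companion_entry i j)) = 0.
  rewrite (det_laplace 4 (fun i j => ev (companion_entry i j))) -beval_blaplace.
  have := beval_zero t y companion_determinant.
  rewrite /bsub beval_add beval_neg beval_mul => /eqP.
  by rewrite subr_eq0 S0 mulr0 => /eqP.
have rows0 : \sum_(i < 4) v 0 i *: row_poly i = 0.
  apply/polyP=> j; rewrite coef0 coef_sum.
  have [ltj|lej] := ltnP j 4; last first.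
    apply: big1 => i _; rewrite coefZ nth_default ?mulr0 //.
    apply: leq_trans (size_Poly _) _; rewrite size_map size_companion_rows.
    exact: lej.
  have /rowP/(_ (Ordinal ltj)) := vN; rewrite !mxE => E; apply: etrans E.
  by apply: eq_bigr => i _; rewrite coefZ mxE companion_entry_coef.
have /boolp.choice[b bE] := row_polyE.
pose A : {poly F} := \sum_(i < 4) (v 0 i * t ^+ i) *: 'X^i.
pose B : {poly F} := \sum_(i < 4) v 0 i *: b i.
have AB : A * row_poly 0 + B * Q_poly = 0.
  rewrite -rows0 /A /B !mulr_suml -big_split /=; apply: eq_bigr => i _.
  by rewrite [in RHS]bE scalerDr -!scalerAl scalerA.
have AE : A = \poly_(i < 4) (if insub i is Some j then v 0 j * t ^+ i else 0).
  rewrite poly_def; apply: eq_bigr => i _.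
  by rewrite valK.
have nz_A : A != 0.
  have [j vj] : exists j, v 0 j != 0 by apply/rV0Pn.
  apply: contraNneq vj => A0.
  have := congr1 (fun p : {poly F} => p`_j) A0.
  rewrite AE coef0 coef_poly ltn_ord valK => /eqP.
  by rewrite mulf_eq0 expf_eq0 (negPf nz_t) andbF orbF.
have szA : (size A < 5)%N by rewrite AE ltnS size_poly.
have : ~~ coprimep Q_poly (row_poly 0).
  apply/negP => coQ; have QA : Q_poly %| A.
    rewrite -(Gauss_dvdpl _ coQ).
    have -> : A * row_poly 0 = - B * Q_poly by apply/eqP; rewrite mulNr -addr_eq0 AB.
    exact: dvdp_mull.
  have := dvdp_leq nz_A QA; rewrite size_Q_poly //.
  by rewrite leqNgt szA.
rewrite coprimep_def => /closed_rootP[s].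
by rewrite root_gcd; exists s.
Qed.

Lemma Q_poly_eval s :
  Q_poly.[s] = y - y ^+ 2 - t * y ^+ 2
    + s * (2 * y + 2 * t * y - 4 * t * y ^+ 2)
    + s ^+ 2 * (6 * t * y - 1 - t - 4 * t * y ^+ 2)
    + s ^+ 3 * (4 * t * y - 2 * t) - t * s ^+ 4.
Proof.
rewrite /Q_poly /= !hornerE /beval /= !ZrE /Pos.to_nat /=; ring.
Qed.

Lemma row_poly0_eval s :
  (row_poly 0).[s] = 
    (1 - 4 * t * y + 4 * t * y ^+ 2 + 4 * t ^+ 2 * y - 8 * t ^+ 2 * y ^+ 2
      + 8 * t ^+ 2 * y ^+ 3 - 4 * t ^+ 3 * y ^+ 2 + 8 * t ^+ 3 * y ^+ 3)
    + s * (1 + t - 8 * t * y - 2 * t ^+ 2 * y + 4 * t ^+ 2 * y ^+ 2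
      + 8 * t ^+ 3 * y - 28 * t ^+ 3 * y ^+ 2 + 32 * t ^+ 3 * y ^+ 3)
    + s ^+ 2 * (6 * t - 16 * t ^+ 2 * y + 16 * t ^+ 2 * y ^+ 2 - 4 * t ^+ 3
      + 26 * t ^+ 3 * y - 48 * t ^+ 3 * y ^+ 2 + 32 * t ^+ 3 * y ^+ 3)
    + s ^+ 3 * (10 * t ^+ 2 - 8 * t ^+ 2 * y - 5 * t ^+ 3 + 16 * t ^+ 3 * y
      - 16 * t ^+ 3 * y ^+ 2).
Proof. rewrite /row_poly /= !hornerE /beval /= !ZrE /Pos.to_nat /=; ring. Qed.

(** F1 and F2 are combinations of the polynomials Q and G, and Q is F2 / 4
    while G is F1 reduced modulo Q. *)
Lemma S_rows_root_exists : t != 0 -> ev S_rows = 0 ->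
  exists s, F1 t s y = 0 /\ F2 t s y = 0.
Proof.
move=> nz_t /(common_root_exists nz_t)[s /andP[/rootP Q0 /rootP G0]].
exists s; split.
  rewrite (_ : F1 t s y = (row_poly 0).[s]
      + 4 * (t ^+ 2 * s + t - t ^+ 2 + 2 * t ^+ 2 * y) * Q_poly.[s]).
    by rewrite Q0 G0 mulr0 addr0.
  rewrite row_poly0_eval Q_poly_eval /F1; ring.
rewrite (_ : F2 t s y = 4 * Q_poly.[s]); first by rewrite Q0 mulr0.
rewrite Q_poly_eval /F2; ring.
Qed.

End CommonRoot.

(** * Cycles of type LLRLR: the equations of a cycle *)

Section LongCycle.
Variables (F : fieldType) (t : F).
Hypothesis nz_2 : 2 != 0 :> F.

(** As for LRLR, but the second replacement x2 replaces x1 in the equations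
    for y; it is x1 + t p s with p = s - 2 x, and x2 differs from x exactly when
    p (1 + t s) is nonzero. *)
Lemma LLRLR_forward (x y : F) :
  periodic (normal_form t) [:: L; L; R; L; R] (x, y) ->
  exists s, [/\ F1 t s y = 0, F2 t s y = 0, 1 + t * s != 0 & x = x_coord s y].
Proof.
move/periodic_LLRLR; rewrite /normal_form; set x1 := t * x ^+ 2 + y ^+ 2.
set x2 := t * x1 ^+ 2 + y ^+ 2; set y1 := t * x2 ^+ 2 + y ^+ 2.
move=> -[hx hy nx nx2 ny].
have a1 : x1 - (t * x ^+ 2 + y ^+ 2) = 0 by rewrite subrr.
have a2 : x2 - (t * x1 ^+ 2 + y ^+ 2) = 0 by rewrite subrr.
have a5 : y1 - (t * x2 ^+ 2 + y ^+ 2) = 0 by rewrite subrr.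
move: x1 x2 y1 a1 a2 a5 hx hy nx nx2 ny => x1 x2 y1 a1 a2 a5 /eqP a3 /eqP a4 nx nx2 ny.
rewrite -subr_eq0 in a3; rewrite -subr_eq0 in a4.
move/eqP: a3 => a3; move/eqP: a4 => a4.
pose s := x + x1; pose q := y1 - y; pose p := - (q * (1 + 2 * s)).
have nz_q : q != 0 by rewrite subr_eq0; apply/eqP.
(* The alternating sum of the equations, except the one for x2. *)
have sy : x + x1 = y + y1.
  apply/eqP; rewrite -subr_eq0; apply/eqP.
  transitivity (x1 - (t * x ^+ 2 + y ^+ 2) + (t * x ^+ 2 + y1 ^+ 2 - y)
    - (y1 - (t * x2 ^+ 2 + y ^+ 2)) - (t * x2 ^+ 2 + y1 ^+ 2 - x)); first by ring.
  by rewrite a1 a5 a3 a4 !subr0 addr0.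
have y1E : y1 = s - y by rewrite /s sy addrC addKr.
have x1E : x1 = s - x by rewrite /s addrC addKr.
have qE : q = s - 2 * y by rewrite /q y1E; ring.
have xE : x = s - y + q * s.
  apply/eqP; rewrite -subr_eq0 qE; apply/eqP.
  transitivity (- (y1 - (t * x2 ^+ 2 + y ^+ 2)) - (t * x2 ^+ 2 + y1 ^+ 2 - x)); last first.
    by rewrite a5 a3 subr0 oppr0.
  rewrite y1E; ring.
have pE : p = s - 2 * x by rewrite xE /p qE; ring.
have x2E : x2 = x1 + t * p * s.
  apply/eqP; rewrite -subr_eq0; apply/eqP.
  transitivity (x2 - (t * x1 ^+ 2 + y ^+ 2) - (x1 - (t * x ^+ 2 + y ^+ 2))).
    rewrite x1E pE; ring.
  by rewrite a1 a2 subr0.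
have xx2 : x - x2 = - (p * (1 + t * s)) by rewrite x2E x1E pE; ring.
exists s; split.
- apply: (mulfI (mulf_neq0 nz_2 nz_q)); rewrite mulr0.
  transitivity (2 * ((t * x ^+ 2 + y1 ^+ 2 - y) - (t * x2 ^+ 2 + y1 ^+ 2 - x))); last first.
    by rewrite a3 a4 subr0 mulr0.
  rewrite x2E x1E /p xE qE /F1; ring.
- transitivity ((x1 - (t * x ^+ 2 + y ^+ 2)) * 4); last by rewrite a1 mul0r.
  rewrite x1E xE qE /F2; ring.
- apply/eqP => ts0; apply: nx2; apply/eqP; rewrite -subr_eq0 -opprB xx2 ts0.
  by rewrite mulr0 !oppr0.
- rewrite /x_coord; apply: (mulIf nz_2); rewrite divfK // {1}xE qE; ring.
Qed.

(** The conditions of minimality fail only if q, 1 + 2 s or 1 + t s vanishes.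
    The first makes t a root of 7 t^3 + 37 t^2 + 17 t + 3, the second
    contradicts F1, and the third gives s = -1 by F1, hence t = 1. *)
Lemma LLRLR_backward (s y : F) :
  3 + 17 * t + 37 * t ^+ 2 + 7 * t ^+ 3 != 0 -> t != 1 ->
  F1 t s y = 0 -> F2 t s y = 0 ->
  periodic (normal_form t) [:: L; L; R; L; R] (x_coord s y, y).
Proof.
move=> nz_disc t1 f1 f2; pose q := s - 2 * y; pose p := - (q * (1 + 2 * s)).
set x := x_coord s y.
have xE : x = s - y + q * s.
  by apply: (mulIf nz_2); rewrite /x /x_coord divfK // /q; ring.
pose x1 := s - x; pose y1 := s - y; pose x2 := x1 + t * p * s.
have pE : p = s - 2 * x by rewrite xE /p /q; ring.
have hx1 : normal_form t x y = x1.
  apply: (mulfI (mulf_neq0 nz_2 nz_2)); apply/eqP; rewrite -subr_eq0; apply/eqP.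
  transitivity (- F2 t s y); last by rewrite f2 oppr0.
  rewrite /normal_form /x1 xE /F2 /q; ring.
have hx2 : normal_form t x1 y = x2.
  apply/eqP; rewrite -subr_eq0; apply/eqP.
  transitivity (normal_form t x y - x1); last by rewrite hx1 subrr.
  rewrite /normal_form /x2 /x1 pE; ring.
have hy1 : normal_form t x2 y = y1.
  apply: (mulfI nz_2); apply/eqP; rewrite -subr_eq0; apply/eqP.
  transitivity (2 * (normal_form t x y - x1) - 2 * q * F1 t s y); last first.
    by rewrite hx1 f1 subrr !mulr0 subr0.
  rewrite /normal_form /x2 /y1 /x1 xE /p /q /F1; ring.
have nz_q : q != 0.
  apply: contra_neq nz_disc => q0.
  have f1' : 1 + s + t * s * (1 + 2 * s) * (1 + t * s) = 0.
    by rewrite -f1 /F1 -/q q0; ring.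
  have f2' : s * ((t + 1) * s - 2) = 0.
    transitivity (- F2 t s y); last by rewrite f2 oppr0.
    have yE : 4 * y ^+ 2 = (s - q) ^+ 2 by rewrite /q; ring.
    by rewrite /F2 yE -/q q0; ring.
  have nz_s : s != 0.
    by apply: contra_eq_neq f1' => s0; rewrite s0 !(mulr0, mul0r, addr0) oner_eq0.
  have es : (t + 1) * s = 2.
    by apply/eqP; rewrite -subr_eq0; move/eqP: f2'; rewrite mulf_eq0 (negPf nz_s).
  transitivity ((t + 1) ^+ 3 * (1 + s + t * s * (1 + 2 * s) * (1 + t * s))).
    have -> : (t + 1) ^+ 3 * (1 + s + t * s * (1 + 2 * s) * (1 + t * s)) =
      (t + 1) ^+ 3 + (t + 1) ^+ 2 * ((t + 1) * s)
      + t * ((t + 1) * s) * ((t + 1) + 2 * ((t + 1) * s)) * ((t + 1) + t * ((t + 1) * s)).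
      by ring.
    by rewrite es; ring.
  by rewrite f1' mulr0.
have nz_w : 1 + 2 * s != 0.
  apply: contra_eq_neq f1 => w0; rewrite /F1 w0 !(mulr0, mul0r, addr0).
  have -> : 1 + s = (1 + 2 * s) - s by ring.
  rewrite w0 sub0r oppr_eq0; apply/eqP => s0.
  by move/eqP: w0; rewrite s0 mulr0 addr0 oner_eq0.
have nz_ts : 1 + t * s != 0.
  apply: contra_neq t1 => ts0.
  have s1 : s = -1.
    apply/eqP; rewrite -addr_eq0 addrC; apply/eqP.
    by rewrite -f1 /F1 ts0 mulr0 mul0r addr0.
  apply/eqP; rewrite eq_sym -subr_eq0; apply/eqP.
  by rewrite -ts0 s1; ring.
have nz_p : p != 0 by rewrite oppr_eq0 mulf_neq0.
apply/periodic_LLRLR; rewrite -/x hx1 hx2 hy1; split.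
- apply/eqP; rewrite -subr_eq0; apply/eqP.
  transitivity (normal_form t x2 y - y1); last by rewrite hy1 subrr.
  rewrite /normal_form /y1 xE /q; ring.
- apply/eqP; rewrite -subr_eq0; apply/eqP.
  transitivity (normal_form t x y - x1); last by rewrite hx1 subrr.
  rewrite /normal_form /x1 /y1 xE /q; ring.
- move=> xx; case/eqP: nz_p; rewrite pE.
  transitivity (x1 - x); last by rewrite xx subrr.
  rewrite /x1; ring.
- move=> xx; case/eqP: (mulf_neq0 nz_p nz_ts).
  transitivity (x2 - x); last by rewrite xx subrr.
  rewrite /x2 /x1 pE; ring.
- move=> yy; case/eqP: nz_q; transitivity (y1 - y); last by rewrite yy subrr.
  rewrite /y1 /q; ring.
Qed.

End LongCycle.

Lemma LLRLR_cycle (F : fieldType) (t x y : F) :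
  2 != 0 :> F -> t != 0 -> ueval F t s_denominator != 0 ->
  periodic (normal_form t) [:: L; L; R; L; R] (x, y) ->
  beval t y S_rows = 0 /\
  x = x_coord (beval t y s_rows / ueval F t s_denominator) y.
Proof.
move=> nz_2 nz_t nz_den /(LLRLR_forward nz_2)[s [f1 f2 nz_ts ->]].
split; first exact: (S_rows_root nz_2 nz_t nz_ts f1 f2).
by rewrite -(s_rows_root nz_2 nz_t nz_ts f1 f2) [_ * s]mulrC mulfK.
Qed.

Lemma S_degrees i : (size (nth [::] S_rows i) <= 7 + i.+1)%N.
Proof. by case: i => [|[|[|[|[|[|[|[|[|[|[|i]]]]]]]]]]] //; rewrite nth_default. Qed.

Lemma S_row0_neq0 (c : rat) : ueval rat c (nth [::] S_rows 0) != 0.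
Proof. exact: (@no_rational_root 3). Qed.

(** * Periodic vectors of a diagonal form *)

Lemma two_neq0 (F : fieldType) (iota : {rmorphism rat -> F}) : 2 != 0 :> F.
Proof. by rewrite -(rmorph_nat iota) fmorph_eq0. Qed.

Definition rows_poly (t : rat) (rows : seq (seq Z)) : {poly rat} :=
  Poly [seq ueval rat t p | p <- rows].

Lemma rows_poly_eval (F : fieldType) (iota : {rmorphism rat -> F}) t rows y :
  (map_poly iota (rows_poly t rows)).[y] = beval (iota t) y rows.
Proof.
rewrite /rows_poly; elim: rows => [|p rows IHr]; first by rewrite map_poly0 horner0.
rewrite /= cons_poly_def rmorphD rmorphM /= map_polyX map_polyC /= !hornerE IHr.
by rewrite (ueval_rmorph iota) addrC mulrC.
Qed.

Definition s_poly (sden : seq Z) (srows : seq (seq Z)) (t : rat) : {poly rat} :=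
  (ueval rat t sden)^-1 *: rows_poly t srows.

(** The polynomials G and H: the fraction for s, composed with y |-> D y to
    return from the normal form, is inserted into [x_coord]. *)
Definition x_poly sden srows (C D : rat) : {poly rat} :=
  let s := s_poly sden srows (C / D) \Po (D *: 'X) in
  (2 * D)^-1 *: (s + (s - (2 * D) *: 'X) * (1 + 2 *: s)).

Lemma x_poly_eval (F : fieldType) (iota : {rmorphism rat -> F}) sden srows C D y :
  D != 0 ->
  (map_poly iota (x_poly sden srows C D)).[y] =
  (iota D)^-1 * x_coord (beval (iota C / iota D) (iota D * y) srows
                          / ueval F (iota C / iota D) sden) (iota D * y).
Proof.
move=> nz_D; rewrite /x_poly; set s := _ \Po _.
have sE : (map_poly iota s).[y] =
    beval (iota C / iota D) (iota D * y) srows / ueval F (iota C / iota D) sden.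
  have eX : (map_poly iota (D *: 'X)).[y] = iota D * y.
    by rewrite map_polyZ map_polyX hornerZ hornerX.
  rewrite /s map_comp_poly horner_comp eX /s_poly map_polyZ hornerZ rows_poly_eval.
  by rewrite fmorphV (ueval_rmorph iota) fmorph_div mulrC.
rewrite map_polyZ rmorphD rmorphM rmorphB rmorphD /= !map_polyZ rmorph1 map_polyX.
set rhs := (X in _ = X).
rewrite !(hornerE, hornerZ) sE fmorphV !rmorphM !rmorph_nat /rhs /x_coord.
move: (beval _ _ srows / _) => sv.
by field; rewrite fmorph_eq0 nz_D (two_neq0 iota).
Qed.

(** The consequences that are common to the two types w.  The rows give a
    polynomial in y that vanishes on the periodic vectors of the normal form,
    and [srows / sden] gives s as a function of y. *)
Section Cycle.

Variables (w : seq letter) (e : nat) (rows srows : seq (seq Z)) (sden : seq Z).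

Definition cycle_poly (C D : rat) : {poly rat} := form_poly e rows C D.

Hypothesis degrees : forall i, (size (nth [::] rows i) <= e + i.+1)%N.
Hypothesis sden_neq0 : forall c : rat, ueval rat c sden != 0.
Hypothesis row0_neq0 : forall c : rat, ueval rat c (nth [::] rows 0) != 0.
Hypothesis rows_gt1 : (1 < size rows)%N.
Hypothesis cycle_forward : forall (F : fieldType) (t x y : F),
  2 != 0 :> F -> t != 0 -> ueval F t sden != 0 ->
  periodic (normal_form t) w (x, y) ->
  beval t y rows = 0 /\ x = x_coord (beval t y srows / ueval F t sden) y.

Section DiagonalForm.

Variables C D : rat.
Hypotheses (nz_C : C != 0) (nz_D : D != 0).
Local Notation G := (x_poly sden srows C D).
Local Notation P := (cycle_poly C D).

Lemma cycle_poly_neq0 : P != 0.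
Proof.
apply/eqP => /(congr1 (fun p : {poly rat} => p`_0)); rewrite coef0 coef_poly.
rewrite (ltnW rows_gt1) form_coefE // => /eqP; apply/negP.
by rewrite mulf_neq0 ?expf_neq0.
Qed.

Lemma size_cycle_poly : (size P <= size rows)%N.
Proof. exact: size_poly. Qed.

Lemma sden_ratio_neq0 (F : fieldType) (iota : {rmorphism rat -> F}) :
  ueval F (iota C / iota D) sden != 0.
Proof. by rewrite -fmorph_div -(ueval_rmorph iota) fmorph_eq0. Qed.

Section Field.

Variables (F : fieldType) (iota : {rmorphism rat -> F}).
Hypothesis iotaE : iota =1 @ratr F.

Let t : F := iota C / iota D.
Let iD_neq0 : iota D != 0. Proof. by rewrite fmorph_eq0. Qed.

Lemma periodic_normal_form (x y : F) :
  periodic (diag_form F C D) w (x, y) <->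
  periodic (normal_form t) w (iota D * x, iota D * y).
Proof.
apply: (@periodic_conj _ _ (diag_form F C D) (normal_form t) (fun a => iota D * a) w (x, y)).
  exact: mulfI.
move=> a b; rewrite /diag_form -!iotaE /normal_form /t.
by field.
Qed.

Lemma root_cycle_poly (y : F) :
  root (map_poly iota P) y = (beval t (iota D * y) rows == 0).
Proof.
rewrite rootE map_form_poly form_poly_eval // mulf_eq0 expf_eq0.
by rewrite (negPf iD_neq0) andbF.
Qed.

Lemma periodic_root (v : F * F) : periodic (diag_form F C D) w v ->
  root (map_poly iota P) v.2 /\ v.1 = (map_poly iota G).[v.2].
Proof.
case: v => x y /periodic_normal_form per.
have nz_t : t != 0 by rewrite mulf_neq0 ?invr_eq0 ?fmorph_eq0.
have [rows0 xE] := cycle_forward (two_neq0 iota) nz_t (sden_ratio_neq0 iota) per.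
rewrite root_cycle_poly rows0 eqxx x_poly_eval //=; split=> //.
by rewrite -xE mulKf.
Qed.

Lemma periodic_generates (v : F * F) : periodic (diag_form F C D) w v ->
  exists2 n, (n <= (size rows).-1)%N & generates_number_field [:: v.1; v.2] n.
Proof.
move=> /periodic_root[Py xE]; have [n len gen] := generates_root G cycle_poly_neq0 Py.
exists n; last by rewrite xE.
by apply: leq_trans len _; rewrite -!subn1 leq_sub2r // size_cycle_poly.
Qed.

Lemma periodic_generates_irreducible (v : F * F) :
  irreducible_poly P -> size P = size rows -> periodic (diag_form F C D) w v ->
  generates_number_field [:: v.1; v.2] (size rows).-1.
Proof.
move=> irrP szP /periodic_root[Py xE].
by rewrite xE -szP; apply: generates_irreducible.
Qed.

Hypothesis cycle_backward : forall y : F, beval t y rows = 0 ->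
  periodic (normal_form t) w (x_coord (beval t y srows / ueval F t sden) y, y).

Lemma root_periodic (y : F) : root (map_poly iota P) y ->
  periodic (diag_form F C D) w ((map_poly iota G).[y], y).
Proof.
rewrite root_cycle_poly => /eqP /cycle_backward per.
by apply/periodic_normal_form; rewrite x_poly_eval // mulVKf.
Qed.

Lemma root_periodic_bij :
  set_bij (roots_in F P) (periodic_vectors F C D w)
          (fun y => ((map_poly ratr G).[y], y)).
Proof.
have mapE p : map_poly (@ratr F) p = map_poly iota p by apply: eq_map_poly => a; rewrite iotaE.
split.
- move=> y /=; rewrite /roots_in /= mapE => Py; rewrite /periodic_vectors /= mapE.
  exact: root_periodic.
- by move=> y z _ _ [].
- move=> v /= /periodic_root[Py xE]; exists v.2; first by rewrite /roots_in /= mapE.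
  by rewrite mapE -xE; case: (v).
Qed.

End Field.

Lemma periodic_card (F : numClosedFieldType) :
  (periodic_vectors F C D w #<= `I_(size rows).-1)%card.
Proof.
pose iota : {rmorphism rat -> F} := @ratr F.
have [rs Prs] := closed_field_poly_normal (map_poly iota P).
have nz_lc : lead_coef (map_poly iota P) != 0.
  by rewrite lead_coef_eq0 map_poly_eq0 cycle_poly_neq0.
have szrs : (size rs <= (size rows).-1)%N.
  have := size_cycle_poly; rewrite -(size_map_poly iota) Prs size_scale // size_prod_XsubC.
  by case: (size rows).
apply: card_le_trans (card_image_le (fun i => ((map_poly iota G).[rs`_i], rs`_i)) _).
apply: subset_card_le => v /(periodic_root (iota := iota) (fun=> erefl))[Py xE].
have v_rs : v.2 \in rs.
  by move: Py; rewrite Prs rootZ // root_prod_XsubC.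
exists (index v.2 rs) => /=.
  by apply: leq_trans szrs; rewrite index_mem.
by rewrite nth_index // -xE; case: (v).
Qed.

End DiagonalForm.

(** The certificate at (c, d) modulo l gives irreducible specialisations at
    all the integer points congruent to (c, d), and these are Zariski dense. *)
Lemma periodic_generates_generic (l : nat) (c d : Z) cert :
  prime l -> irreducible_certificate l (Z_form e rows c d) cert ->
  exists A : set (2.-tuple rat), thin A /\
    forall C D : rat, C != 0 -> D != 0 -> ~ A [tuple C; D] ->
    forall F : fieldType, [pchar F] =i pred0 ->
    forall v : F * F, periodic (diag_form F C D) w v ->
      generates_number_field [:: v.1; v.2] (size rows).-1.
Proof.
move=> pr_l irr_cert.
pose P2 : {poly {mpoly rat[2]}} := form_poly e rows 'X_ord0 'X_ord_max.
have specE (a : 2.-tuple rat) :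
    specialize a P2 = form_poly e rows (tnth a ord0) (tnth a ord_max).
  by rewrite /specialize map_form_poly /= !mevalXU.
have l_gt0 := prime_gt0 pr_l.
pose X (i : 'I_2) (k : nat) : rat :=
  (int_of_Z (if i == ord0 then c else d) + (l * k)%:Z)%:~R.
have X_Fl (i : 'I_2) k :
    (int_of_Z (if i == ord0 then c else d) + (l * k)%:Z)%:~R
    = Zr 'F_l (if i == ord0 then c else d).
  rewrite intrD /Zr -[_%:Z%:~R]/((l * k)%:R) natrM.
  by rewrite (pcharf0 (pchar_Fp pr_l)) mul0r addr0.
have irrP2 : generically_irreducible P2.
  move=> q nz_q; have [|k nz_k] := @mpoly_nonvanishing _ 2 X q _ nz_q.
    move=> i k k' /intr_inj /addrI [] /eqP.
    by rewrite eqn_mul2l -[(l == 0)%N]negbK -lt0n l_gt0 => /eqP.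
  exists [tuple X i (k i) | i < 2]; split.
    by rewrite (meval_eq (v2 := fun i => X i (k i))) // => i; rewrite tnth_mktuple.
  rewrite specE !tnth_mktuple.
  exact: (form_irreducible_mod pr_l irr_cert (X_Fl ord0 _) (X_Fl ord_max _)).1.
have szP2 : size P2 = size rows.
  have [a [_ _]] := irrP2 1 (oner_neq0 _).
  apply/eqP; rewrite eqn_leq size_poly /=.
  have [_ <-] := form_irreducible_mod pr_l irr_cert (X_Fl ord0 0%N) (X_Fl ord_max 0%N).
  have -> : form_poly e rows (X ord0 0%N) (X ord_max 0%N) =
      specialize [tuple X i 0%N | i < 2] P2 by rewrite specE !tnth_mktuple.
  exact: size_poly.
have P2_gt1 : (1 < size P2)%N by rewrite szP2.
exists [set a | ~ (irreducible_poly (specialize a P2)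
                   /\ size (specialize a P2) = size P2)]%classic.
split; first exact: thin_reducible.
move=> C D nz_C nz_D /= /boolp.contrapT[]; rewrite specE szP2 => irr szP F charF v per.
have [iota iotaE] := rat_morphism_pchar0 charF.
by apply: (periodic_generates_irreducible nz_C nz_D iotaE irr szP per).
Qed.

End Cycle.

(** * The polynomials of the two types *)

(** Certificates for (C, D) = (2, 1) modulo 13, a prime modulo which both
    polynomials stay irreducible at this point. *)
Section Certificates.
Local Open Scope Z_scope.

Definition R_certificate : seq (seq Z * seq Z) :=
  [:: ([:: 7; 3; 11; 9], [:: 9; 7; 6; 11]);
      ([:: 7; 8; 0; 7], [:: 5; 8; 9; 5])].

Definition S_certificate : seq (seq Z * seq Z) :=
  [:: ([:: 0; 11; 8; 7; 11; 12; 1; 8; 9; 5], [:: 0; 2; 8; 5; 8; 6; 10; 7; 7; 8]);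
      ([:: 7; 2; 12; 8; 1; 7; 2; 4; 5; 7], [:: 7; 5; 6; 2; 9; 1; 1; 2; 6; 7]);
      ([:: 7; 6; 1; 1; 9; 5; 3; 3; 9; 6], [:: 9; 5; 5; 2; 6; 0; 6; 10; 7; 7]);
      ([:: 10; 1; 2; 4; 6; 7; 9; 11; 9; 9], [:: 11; 2; 1; 6; 2; 0; 2; 5; 9; 3]);
      ([:: 3; 7; 3; 9; 0; 8; 2; 2; 4; 1], [:: 11; 4; 7; 4; 9; 11; 1; 4; 10; 7])].

End Certificates.

Lemma R_irreducible_certificate :
  irreducible_certificate 13 (Z_form 3 R_rows (Zpos 2) (Zpos 1)) R_certificate.
Proof. by vm_compute. Qed.

Lemma S_irreducible_certificate :
  irreducible_certificate 13 (Z_form 7 S_rows (Zpos 2) (Zpos 1)) S_certificate.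
Proof. by vm_compute. Qed.

Lemma R_poly_rows C D : R_poly C D = form_poly 3 R_rows C D.
Proof.
apply/polyP => i; rewrite /R_poly !(coefD, coefZ, coefXn, coefX, coefC).
case: i => [|[|[|[|[|i]]]]]; rewrite coef_poly /form_coef /= ?ZrE /Pos.to_nat /=.
all: ring.
Qed.

Lemma S_poly_rows C D : S_poly C D = form_poly 7 S_rows C D.
Proof.
apply/polyP => i; rewrite /S_poly !(coefD, coefZ, coefXn) coef_sum.
rewrite !big_ord_recl big_ord0 !(coefZ, coefXn).
case: i => [|[|[|[|[|[|[|[|[|[|[|i]]]]]]]]]]]; rewrite coef_poly /form_coef /= ?ZrE /Pos.to_nat /=.
all: ring.
Qed.

Lemma ueval_ratio (F : fieldType) (iota : {rmorphism rat -> F}) (C D : rat) p :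
  ueval F (iota C / iota D) p = iota (ueval rat (C / D) p).
Proof. by rewrite (ueval_rmorph iota) fmorph_div. Qed.

Section RationalParameters.
Variables (F : fieldType) (iota : {rmorphism rat -> F}) (C D : rat).
Hypotheses (nz_C : C != 0) (nz_D : D != 0).
Let t : F := iota C / iota D.

(** The exceptional polynomials have no rational root, so they do not vanish
    at C / D. *)
Lemma LRLR_converse (y : F) : beval t y R_rows = 0 ->
  periodic (normal_form t) [:: L; R; L; R]
    (x_coord (beval t y sR_rows / ueval F t sR_denominator) y, y).
Proof.
have nz_2 := two_neq0 iota => /R_rows_root_exists[].
  by rewrite /t ueval_ratio fmorph_eq0 sR_denominator_neq0.
apply: LRLR_backward => //.
have -> : 3 * t ^+ 2 + 14 * t + 3 = ueval F t [:: Zpos 3; Zpos 14; Zpos 3].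
  by rewrite /= !ZrE /Pos.to_nat /=; ring.
by rewrite /t ueval_ratio fmorph_eq0; apply: (@no_rational_root 7).
Qed.
End RationalParameters.

(** The common root s exists for an abstract reason; applying the forward
    direction to the cycle it defines shows that it is the given fraction. *)
Lemma LLRLR_converse (F : closedFieldType) (iota : {rmorphism rat -> F}) (C D : rat) (y : F) :
  let t := iota C / iota D in
  C != 0 -> D != 0 -> C != D -> beval t y S_rows = 0 ->
  periodic (normal_form t) [:: L; L; R; L; R]
    (x_coord (beval t y s_rows / ueval F t s_denominator) y, y).
Proof.
move=> t nz_C nz_D CD S0; have nz_2 := two_neq0 iota.
have nz_t : t != 0 by rewrite mulf_neq0 ?invr_eq0 ?fmorph_eq0.
have t1 : t != 1.
  apply: contra_neq CD => /(congr1 (fun z => z * iota D)).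
  by rewrite mul1r divfK ?fmorph_eq0 // => /fmorph_inj.
have [s [f1 f2]] := S_rows_root_exists nz_t S0.
have per : periodic (normal_form t) [:: L; L; R; L; R] (x_coord s y, y).
  apply: LLRLR_backward => //.
  have -> : 3 + 17 * t + 37 * t ^+ 2 + 7 * t ^+ 3
      = ueval F t [:: Zpos 3; Zpos 17; Zpos 37; Zpos 7].
    by rewrite /= !ZrE /Pos.to_nat /=; ring.
  by rewrite /t ueval_ratio fmorph_eq0; apply: (@no_rational_root 5).
have nz_den : ueval F t s_denominator != 0.
  by rewrite /t ueval_ratio fmorph_eq0 s_denominator_neq0.
by have [_ <-] := LLRLR_cycle nz_2 nz_t nz_den per.
Qed.

Lemma size_R_poly (C D : rat) : C != 0 -> D != 0 -> C != D -> size (R_poly C D) = 5%N.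
Proof.
move=> nz_C nz_D CD; rewrite R_poly_rows; apply/eqP; rewrite eqn_leq size_poly /=.
rewrite ltnNge; apply/negP => le4; have /eqP := nth_default 0 le4.
rewrite -R_poly_rows /R_poly !(coefD, coefZ, coefXn, coefX, coefC) /=.
rewrite !mulr0 !addr0 mulr1; apply/negP.
by rewrite !mulf_neq0 ?expf_neq0 ?pnatr_eq0 ?subr_eq0 // eq_sym.
Qed.

Lemma coef10_sum (K : nzRingType) (a b c d : K) (e : 'I_7 -> K) :
  (a *: 'X^10 + b *: 'X^9 + c *: 'X^8 + d *: 'X^7 + \sum_(i < 7) e i *: 'X^i)`_10 = a.
Proof.
rewrite !(coefD, coefZ, coefXn) coef_sum big1 => [|i _].
  by rewrite /= !mulr0 mulr1 !addr0.
by rewrite coefZ coefXn gtn_eqF ?mulr0 // (leq_trans (ltn_ord i)).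
Qed.

Lemma size_S_poly (C D : rat) : C != 0 -> D != 0 -> C != - D ->
  C ^+ 2 - 3 * C * D + 4 * D ^+ 2 != 0 -> size (S_poly C D) = 11%N.
Proof.
move=> nz_C nz_D CD nz_q; have nz_CD : C + D != 0 by rewrite addr_eq0.
have c10 : (S_poly C D)`_10 != 0.
  rewrite /S_poly coef10_sum; apply: mulf_neq0 nz_q.
  apply: mulf_neq0 (expf_neq0 _ nz_CD); apply: mulf_neq0 (expf_neq0 _ nz_D).
  by apply: mulf_neq0 (expf_neq0 _ nz_C); rewrite pnatr_eq0.
move: c10; rewrite S_poly_rows => c10; apply/eqP; rewrite eqn_leq size_poly ltnNge.
by apply: contra c10 => le10; rewrite nth_default.
Qed.

(** * The theorem *)

Lemma number_field_rat_morphism (K : fieldExtType rat) :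
  {iota : {rmorphism rat -> K} | iota =1 @ratr K}.
Proof.
by apply: rat_morphism_pchar0 => p; rewrite (pchar_lalg K) pchar_num.
Qed.

Section Assembly.

Variables C D : rat.
Hypotheses (nz_C : C != 0) (nz_D : D != 0).

Section Field.

Variables (F : fieldType) (iota : {rmorphism rat -> F}).
Hypothesis iotaE : iota =1 @ratr F.

Lemma map_ratrE p : map_poly (@ratr F) p = map_poly iota p.
Proof. by apply: eq_map_poly => a; rewrite iotaE. Qed.

Lemma LRLR_periodic_root (v : F * F) : periodic (diag_form F C D) [:: L; R; L; R] v ->
  root (map_poly ratr (R_poly C D)) v.2.
Proof.
move=> per; rewrite map_ratrE R_poly_rows.
exact: (periodic_root R_degrees sR_denominator_neq0 LRLR_cycle nz_C nz_D iotaE per).1.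
Qed.

Lemma LLRLR_periodic_root (v : F * F) : periodic (diag_form F C D) [:: L; L; R; L; R] v ->
  root (map_poly ratr (S_poly C D)) v.2.
Proof.
move=> per; rewrite map_ratrE S_poly_rows.
exact: (periodic_root S_degrees s_denominator_neq0 LLRLR_cycle nz_C nz_D iotaE per).1.
Qed.

Lemma LRLR_root_periodic (y : F) : root (map_poly ratr (R_poly C D)) y ->
  exists v, periodic (diag_form F C D) [:: L; R; L; R] v.
Proof.
rewrite map_ratrE R_poly_rows => Ry.
exists ((map_poly iota (x_poly sR_denominator sR_rows C D)).[y], y).
by apply: (root_periodic R_degrees nz_D iotaE _ Ry) => z; apply: LRLR_converse.
Qed.

(** For C = D the polynomial R is the nonzero constant 5 C^3. *)
Lemma LRLR_periodic_neq (v : F * F) : periodic (diag_form F C D) [:: L; R; L; R] v -> C <> D.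
Proof.
move=> /LRLR_periodic_root; rewrite map_ratrE => + CD; rewrite -CD /R_poly subrr.
have -> : C ^+ 3 - 2 * C * C ^+ 2 + 5 * C ^+ 2 * C + C ^+ 3 = 5 * C ^+ 3 by ring.
rewrite expr0n !(mulr0, scale0r, add0r) map_polyC rootC fmorph_eq0; apply/negP.
by rewrite mulf_neq0 ?expf_neq0 ?pnatr_eq0.
Qed.

End Field.

Lemma LRLR_exists : (exists v, periodic (diag_form algC C D) [:: L; R; L; R] v) <-> C <> D.
Proof.
split=> [[v]|/eqP CD].
  exact: (@LRLR_periodic_neq _ (@ratr algC : {rmorphism rat -> algC}) (fun=> erefl)).
have [y Ry] : exists y : algC, root (map_poly ratr (R_poly C D)) y.
  by apply/closed_rootP; rewrite size_map_poly size_R_poly.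
exact: (@LRLR_root_periodic _ (@ratr algC : {rmorphism rat -> algC}) (fun=> erefl) _ Ry).
Qed.

Lemma LRLR_periodic_bij : exists G : {poly rat},
  set_bij (roots_in algC (R_poly C D))
          (periodic_vectors algC C D [:: L; R; L; R])
          (fun y => ((map_poly ratr G).[y], y)).
Proof.
exists (x_poly sR_denominator sR_rows C D); rewrite R_poly_rows.
apply: (@root_periodic_bij _ _ _ _ _ R_degrees sR_denominator_neq0 LRLR_cycle
          _ _ nz_C nz_D algC (@ratr algC : {rmorphism rat -> algC}) (fun=> erefl)).
by move=> y; apply: LRLR_converse.
Qed.

Lemma LLRLR_periodic_bij : C <> D -> exists H : {poly rat},
  set_bij (roots_in algC (S_poly C D))
          (periodic_vectors algC C D [:: L; L; R; L; R])
          (fun y => ((map_poly ratr H).[y], y)).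
Proof.
move=> /eqP CD; exists (x_poly s_denominator s_rows C D); rewrite S_poly_rows.
apply: (@root_periodic_bij _ _ _ _ _ S_degrees s_denominator_neq0 LLRLR_cycle
          _ _ nz_C nz_D algC (@ratr algC : {rmorphism rat -> algC}) (fun=> erefl)).
by move=> y; apply: LLRLR_converse.
Qed.

End Assembly.

Theorem theorem1p7 :
  ((forall C D : rat, C != 0 -> D != 0 ->
     [/\ (exists v, periodic (diag_form algC C D) [:: L; R; L; R] v) <-> C <> D,
         exists G : {poly rat},
           set_bij (roots_in algC (R_poly C D))
                   (periodic_vectors algC C D [:: L; R; L; R])
                   (fun y => ((map_poly ratr G).[y], y)),
         forall RR : realType,
           (periodic_vectors RR[i] C D [:: L; R; L; R] #<= `I_4)%card,
         forall F : fieldType, [pchar F] =i pred0 ->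
           forall v : F * F, periodic (diag_form F C D) [:: L; R; L; R] v ->
           exists2 n : nat, (n <= 4)%N &
             generates_number_field [:: v.1; v.2] n
       & forall K : fieldExtType rat,
           (exists v, periodic (diag_form K C D) [:: L; R; L; R] v) <->
           (exists y : K, root (map_poly ratr (R_poly C D)) y)])
   /\
   (exists A : set (2.-tuple rat), thin A /\
      forall C D : rat, C != 0 -> D != 0 -> ~ A [tuple C; D] ->
      forall F : fieldType, [pchar F] =i pred0 ->
      forall v : F * F, periodic (diag_form F C D) [:: L; R; L; R] v ->
        generates_number_field [:: v.1; v.2] 4))
  /\
  ((forall C D : rat, C != 0 -> D != 0 ->
     [/\ forall v, periodic (diag_form algC C D) [:: L; L; R; L; R] v ->
           root (map_poly ratr (S_poly C D)) v.2,
         (~ (C = - D \/ C ^+ 2 - 3 * C * D + 4 * D ^+ 2 = 0) ->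
           size (S_poly C D) = 11%N)
         /\
         (C <> D ->
           exists H : {poly rat},
             set_bij (roots_in algC (S_poly C D))
                     (periodic_vectors algC C D [:: L; L; R; L; R])
                     (fun y => ((map_poly ratr H).[y], y))),
         forall RR : realType,
           (periodic_vectors RR[i] C D [:: L; L; R; L; R] #<= `I_10)%card,
         forall F : fieldType, [pchar F] =i pred0 ->
           forall v : F * F, periodic (diag_form F C D) [:: L; L; R; L; R] v ->
           exists2 n : nat, (n <= 10)%N &
             generates_number_field [:: v.1; v.2] n
       & forall K : fieldExtType rat,
           (exists v, periodic (diag_form K C D) [:: L; L; R; L; R] v) ->
           (exists y : K, root (map_poly ratr (S_poly C D)) y)])
   /\
   (exists A : set (2.-tuple rat), thin A /\
      forall C D : rat, C != 0 -> D != 0 -> ~ A [tuple C; D] ->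
      forall F : fieldType, [pchar F] =i pred0 ->
      forall v : F * F, periodic (diag_form F C D) [:: L; L; R; L; R] v ->
        generates_number_field [:: v.1; v.2] 10)).
Proof.
split; split.
- move=> C D nz_C nz_D; split.
  + exact: LRLR_exists.
  + exact: LRLR_periodic_bij.
  + move=> RR; exact: (periodic_card R_degrees sR_denominator_neq0 R_row0_neq0 isT LRLR_cycle).
  + move=> F /rat_morphism_pchar0[iota iotaE] v.
    exact: (periodic_generates R_degrees sR_denominator_neq0 R_row0_neq0 isT LRLR_cycle
              nz_C nz_D iotaE).
  + move=> K; have [iota iotaE] := number_field_rat_morphism K; split=> -[v].
      by move=> per; exists v.2; apply: (LRLR_periodic_root nz_C nz_D iotaE per).
    exact: (LRLR_root_periodic nz_D iotaE).
- exact: (periodic_generates_generic R_degrees sR_denominator_neq0 isT LRLR_cycle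
            (isT : prime 13) R_irreducible_certificate).
- move=> C D nz_C nz_D; split.
  + move=> v.
    exact: (@LLRLR_periodic_root _ _ nz_C nz_D _ (@ratr algC : {rmorphism rat -> algC})
              (fun=> erefl)).
  + split; last exact: LLRLR_periodic_bij.
    by move=> CD; apply: size_S_poly => //; apply/eqP => eq0; apply: CD; [left|right].
  + move=> RR; exact: (periodic_card S_degrees s_denominator_neq0 S_row0_neq0 isT LLRLR_cycle).
  + move=> F /rat_morphism_pchar0[iota iotaE] v.
    exact: (periodic_generates S_degrees s_denominator_neq0 S_row0_neq0 isT LLRLR_cycle
              nz_C nz_D iotaE).
  + move=> K; have [iota iotaE] := number_field_rat_morphism K => -[v per].
    by exists v.2; apply: (LLRLR_periodic_root nz_C nz_D iotaE per).
- exact: (periodic_generates_generic S_degrees s_denominator_neq0 isT LLRLR_cycle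
            (isT : prime 13) S_irreducible_certificate).
Qed.
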